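(* Let $\mu,\lambda\in(0,1)$, let $S^2$ be a $(0,\infty)$-valued $\mathbb F$-adapted process, and let $K=(K_t)_{t\in\mathbb T}$ be given by $$K_t(\omega)=\big\{x\in\mathbb R^2:\ x^1+S^2_t(\omega)\big[(1-\mu)x^2\mathbf 1_{x^2\ge0}+(1+\lambda)x^2\mathbf 1_{x^2<0}\big]\ge0\big\}.$$ Assume that $A^s(K)$ is closed in measure and that $A_T(0;K)\cap L^0(\mathbb R^2_+;\mathcal F)=\{0\}$. Then for every $\vartheta\in L^0(\mathbb R^2;\mathbb F)$ such that $\vartheta^1$ and $\vartheta^2$ are uniformly bounded from below, $$\inf\{x^1\in\mathbb R:\ (x^1,0)\in\Gamma(\vartheta;K)\}=\sup_{(\chi,q)\in\mathcal Q(K,\mathbb P)}E^q_0\big[\vartheta^1+\chi\,\vartheta^2S^2\big].$$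
   Context: Setting: $\mathbb T=\{0,\dots,T\}$ with an integer $T\ge1$; $(\Omega,\mathcal F,\mathbb P)$ is a complete probability space with filtration $\mathbb F=(\mathcal F_t)_{t\in\mathbb T}$, $\mathcal F_T=\mathcal F$, $\mathcal F_0$ trivial. Relations between random variables are understood $\mathbb P$-a.s. There are two assets: a non-risky one with price $S^1\equiv1$ and a risky one with price $S^2$. $L^0(E;\mathbb F)$ (resp. $L^0(E;\mathcal F)$) is the set of $\mathbb F$-adapted processes indexed by $\mathbb T$ (resp. $\mathcal F$-measurable random variables) with values in $E$; $L^1(E;\mathbb F,\mathbb P)$ is the subset of processes in $L^0(E;\mathbb F)$ that are $\mathbb P$-integrable at every $t\in\mathbb T$. $\mathcal A(K)=\{\xi\in L^0(\mathbb R^2;\mathbb F):\xi_t\in -K_t\ \forall t\in\mathbb T\}$; $V^{x,\xi}_t=x+\sum_{s=0}^t\xi_s$ for $x\in\mathbb R^2$; $A(x;K)=\{V^{x,\xi}:\xi\in\mathcal A(K)\}$; $A_T(x;K)=\{V_T:V\in A(x;K)\}$; $A^s(x;K)=\{\vartheta\in L^0(\mathbb R^2;\mathbb F): \exists V\in A(x;K)\text{ with }V_t-\vartheta_t\in K_t\ \forall t\in\mathbb T\}$; $A^s(K)=A^s(0;K)$; $\Gamma(\vartheta;K)=\{x\in\mathbb R^2:\vartheta\in A^s(x;K)\}$. A subset $B\subset L^0(\mathbb R^2;\mathbb F)$ is closed in measure if: $v^n\in B$ and $\lim_n\mathbb P[\sum_{t\in\mathbb T}\|v^n_t-v_t\|>\varepsilon]=0$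 for all $\varepsilon>0$ imply $v\in B$. For a nonnegative adapted process $q$ and an adapted process $\alpha$ for which the expression is well defined, $E^q_t[\alpha]:=\mathbb E[\sum_{t\le s\le T}q_s\alpha_s\mid\mathcal F_t]$; $\mathbf 1$ in the argument of $E^q_t$ denotes the constant process equal to $1$. $\mathcal Q(K,\mathbb P)$ is the set of $(\chi,q)\in L^1(\mathbb R^2_+;\mathbb F,\mathbb P)$ such that $\mathbb E[\sum_{t\in\mathbb T}q_t]=1$ and, for all $t\in\mathbb T$, $1-\mu\le\chi_t\le1+\lambda$ and $$S^2_t(1-\mu)E^q_t[\mathbf 1]\le E^q_t[\chi S^2]\le S^2_t(1+\lambda)E^q_t[\mathbf 1].$$ Convention: $\inf\emptyset=+\infty$. *)

(* Defs.v *)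
From HB Require Import structures.
From mathcomp Require Import all_boot all_order all_algebra.
From mathcomp Require Import all_classical all_reals all_analysis.
From mathcomp Require Import measurable_realfun.

Set Implicit Arguments.
Unset Strict Implicit.
Unset Printing Implicit Defensive.

Import Order.TTheory GRing.Theory Num.Theory.
Import numFieldNormedType.Exports.

Local Open Scope classical_set_scope.
Local Open Scope ring_scope.

(* Random variables are represented by functions on Omega. Every relation
   between them is required P-almost surely, so that all the sets of random
   variables and processes below are stable under a.s. modification by adapted
   (measurable) functions, except that the set A(x; K) of portfolio processes
   consists of the exact partial sums of an adapted xi. *)

Definition process (T : nat) (Omega E : Type) := 'I_T.+1 -> Omega -> E.

Section Processes.
Context {d : measure_display} {Omega : measurableType d} {R : realType}.
Variables (P : probability Omega R) (T : nat) (F : 'I_T.+1 -> set (set Omega)).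

(* F_0 is not assumed to contain the null sets, nor to be {set0, setT}: both
   readings of "trivial" are covered. *)
Definition filtration : Prop :=
  [/\ forall t, sigma_algebra setT (F t),
      forall s t : 'I_T.+1, (s <= t)%N -> F s `<=` F t,
      F ord_max = measurable &
      forall A, F ord0 A -> P A = 0%E \/ P A = 1%E].

Definition L0 {dE} {E : measurableType dE} : set (process T Omega E) :=
  [set X | forall t, measurable_fun setT (X t : g_sigma_algebraType (F t) -> E)].

Definition L1plus : set (process T Omega R) :=
  [set X : process T Omega R | [/\ L0 X, forall t, {ae P, forall w, 0 <= X t w} &
               forall t, P.-integrable setT (EFin \o X t)]].

Definition L0plus_terminal : set (Omega -> R * R) :=
  [set Y : Omega -> R * R | measurable_fun setT Y /\
           {ae P, forall w, 0 <= (Y w).1 /\ 0 <= (Y w).2}].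

(* The class of 0 in L^0(R^2; F). *)
Definition zero_terminal : set (Omega -> R * R) :=
  [set Y : Omega -> R * R | measurable_fun setT Y /\ {ae P, forall w, Y w = 0}].

(* `|_| is the max norm on R * R; the notion does not depend on the norm. *)
Definition closed_in_measure (B : set (process T Omega (R * R))) : Prop :=
  forall (v_ : nat -> process T Omega (R * R)) (v : process T Omega (R * R)),
    (forall n, B (v_ n)) -> L0 v ->
    (forall e : R, 0 < e ->
       P [set w | e < \sum_(t < T.+1) `|v_ n t w - v t w|] @[n --> \oo]
         --> 0%E) ->
    B v.

Section Portfolios.
Variable K : 'I_T.+1 -> Omega -> set (R * R).

Definition strategies : set (process T Omega (R * R)) :=
  [set xi : process T Omega (R * R) | L0 xi /\ forall t, {ae P, forall w, K t w (- xi t w)}].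

Definition wealth (x : R * R) (xi : process T Omega (R * R)) :
    process T Omega (R * R) :=
  fun t w => x + \sum_(s < T.+1 | (s <= t)%N) xi s w.

Definition portfolios (x : R * R) : set (process T Omega (R * R)) :=
  [set wealth x xi | xi in strategies].

Definition terminal_portfolios (x : R * R) : set (Omega -> R * R) :=
  [set V ord_max | V in portfolios x].

Definition superhedgeable (x : R * R) : set (process T Omega (R * R)) :=
  [set theta : process T Omega (R * R) | L0 theta /\
     exists2 V, portfolios x V &
       forall t, {ae P, forall w, K t w (V t w - theta t w)}].

Definition Gamma (theta : process T Omega (R * R)) : set (R * R) :=
  [set x | superhedgeable x theta].

End Portfolios.

(* Y is a version of E[X | G], where X is quasi-integrable and Y may take
   infinite values. Versions are a.s. unique. *)
Definition is_condE (G : set (set Omega)) (X Y : Omega -> \bar R) : Prop :=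
  [/\ (\int[P]_w (X^\+ w) < +oo)%E \/ (\int[P]_w (X^\- w) < +oo)%E,
      measurable_fun setT (Y : g_sigma_algebraType G -> \bar R) &
      forall A, G A -> (\int[P]_(w in A) Y w = \int[P]_(w in A) X w)%E].

(* Y = E^q_t[alpha] a.s. *)
Definition is_Eq (q : process T Omega R) (t : 'I_T.+1)
    (alpha : process T Omega R) (Y : Omega -> \bar R) : Prop :=
  is_condE (F t)
    (fun w => (\sum_(s < T.+1 | (t <= s)%N) q s w * alpha s w)%:E) Y.

Section TransactionCosts.
Variables (mu lambda : R) (S : process T Omega R).

Definition solvency (t : 'I_T.+1) (w : Omega) : set (R * R) :=
  [set x | 0 <= x.1 + S t w * ((1 - mu) * x.2 * (0 <= x.2)%R%:R
                               + (1 + lambda) * x.2 * (x.2 < 0)%R%:R)].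

(* As E^q_t[1] and E^q_t[chi S] are a.s. unique, the inequalities between them
   do not depend on the versions m1 and mS. *)
Definition Q : set (process T Omega R * process T Omega R) :=
  [set cq | let: (chi, q) := cq in
    [/\ L1plus chi, L1plus q,
        ('E_P[(fun w => \sum_(t < T.+1) q t w)%R] = 1)%E,
        forall t, {ae P, forall w, 1 - mu <= chi t w <= 1 + lambda} &
        forall t, exists m1 mS : Omega -> \bar R,
          [/\ is_Eq q t (fun _ _ => 1) m1,
              is_Eq q t (fun s w => chi s w * S s w) mS &
              {ae P, forall w,
                 ((S t w * (1 - mu))%:E * m1 w <= mS w)%E /\
                 (mS w <= (S t w * (1 + lambda))%:E * m1 w)%E}]]].

End TransactionCosts.

(* F_0 being trivial, E^q_0[alpha] is a.s. constant; c is its value. *)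
Definition is_Eq0 (q alpha : process T Omega R) (c : \bar R) : Prop :=
  is_Eq q ord0 alpha (cst c).

End Processes.

(* Main.v *)
Require Import Defs.
From HB Require Import structures.
From mathcomp Require Import all_boot all_order all_algebra.
From mathcomp Require Import all_classical all_reals all_analysis.
From mathcomp Require Import measurable_realfun ring lra.
Import Order.TTheory GRing.Theory Num.Theory.
Import numFieldNormedType.Exports.
Local Open Scope classical_set_scope.
Local Open Scope ring_scope.

Set Implicit Arguments.
Unset Strict Implicit.
Unset Printing Implicit Defensive.

(** The equality splits into two inequalities, and both rest on one notion: a
    pair (a, b) of integrable random variables is dual at date t
    ([dual_pair]) when E[eta^1 a + eta^2 b] >= 0 for all bounded
    F_t-measurable positions eta in K_t. This is the weak form of the statement
    that the conditional expectations of a and b given F_t lie in the dual cone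
    of K_t. For (chi, q) in Q write p_t = q_t chi_t S_t; the inequalities that
    define Q say exactly that (sum_{s >= t} q_s, sum_{s >= t} p_s) is a dual
    pair for each t ([Q_consistent] and [Q_of_prices]).

    Supremum below infimum ([weak_duality]). Let V superhedge theta from
    (x1, 0). If theta >= -C then V + (C, C) is solvent at all dates, so that
    each gain q_t V_t^1 + p_t V_t^2 is nonnegative after this shift. The
    transfers xi need not be integrable. They are made bounded by
    liquidating the position as soon as it leaves the box of size n; a solvent
    position may always be liquidated, so the stopped portfolio is still
    self-financing up to disposals. Abel summation turns its total gain into
    the initial value plus pairings of its transfers with the dual pairs above,
    and these pairings are not positive ([E_stopped_le]). Monotone convergence
    in n gives the bound for V.

    Infimum below supremum ([strong_duality]). If (x1, 0) does not superhedge
    theta, then h = theta - (x1, 0) is not in the cone A^s(K). Choose the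
    adapted weight rho_t = exp(-|h_t|^2), so that h is in the Hilbert space of
    adapted processes with the inner product E sum_t rho_t <u_t, v_t>. Closedness
    in measure makes the trace of A^s(K) on this space a closed convex cone. Let p be
    the projection of h on it and f = h - p. Both h and p are adapted, hence so is f, and
    the separating functional is a pair of adapted price processes
    (rho f^1, rho f^2) at once. Testing f against the disposal of a position of
    K_t at the single date t, and against the same transfer kept until T,
    gives the dual pairs that make the normalized prices an element of Q; its
    value on theta exceeds x1 because f is positive on h ([separation]). *)

(** * Integrable random variables *)

Section RealIntegrals.
Context {d : measure_display} {Omega : measurableType d} {R : realType}.
Variable P : probability Omega R.
Implicit Types f g h : Omega -> R.

Definition integrable_rv f := P.-integrable setT (EFin \o f).
Local Notation L1 := integrable_rv.
Local Notation E f := (\int[P]_w f w).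

Lemma L1_measurable f : L1 f -> measurable_fun setT f.
Proof. by move=> /measurable_int/measurable_EFinP. Qed.

Lemma L1D f g : L1 f -> L1 g -> L1 (fun w => f w + g w).
Proof. by move=> If Ig; exact: integrableD If Ig. Qed.

Lemma L1B f g : L1 f -> L1 g -> L1 (fun w => f w - g w).
Proof. by move=> If Ig; exact: integrableB If Ig. Qed.

Lemma L1Z c f : L1 f -> L1 (fun w => c * f w).
Proof. by move=> If; exact: integrableZl If. Qed.

Lemma L1_norm f : L1 f -> L1 (fun w => `|f w|).
Proof. by move=> If; exact: integrable_norm. Qed.

Lemma L1_cst c : L1 (fun=> c).
Proof. exact: finite_measure_integrable_cst. Qed.

Lemma L1_sum (I : Type) (s : seq I) (Q : pred I) (f : I -> Omega -> R) :
  (forall i, Q i -> L1 (f i)) -> L1 (fun w => \sum_(i <- s | Q i) f i w).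
Proof.
move=> If; elim: s => [|i s IH].
  rewrite (_ : (fun _ => _) = fun=> 0); first exact: L1_cst.
  by apply/funext => w; rewrite big_nil.
case: (boolP (Q i)) => Qi.
  rewrite (_ : (fun _ => _) =
      fun w => f i w + \sum_(j <- s | Q j) f j w); first exact: L1D (If _ Qi) IH.
  by apply/funext => w; rewrite big_cons Qi.
rewrite (_ : (fun _ => _) = fun w => \sum_(j <- s | Q j) f j w) //.
by apply/funext => w; rewrite big_cons (negbTE Qi).
Qed.

Lemma E_sum (I : Type) (s : seq I) (Q : pred I) (f : I -> Omega -> R) :
  (forall i, Q i -> L1 (f i)) ->
  E (fun w => \sum_(i <- s | Q i) f i w) = \sum_(i <- s | Q i) E (f i).
Proof.
move=> If; elim: s => [|i s IH].
  under eq_Rintegral do rewrite big_nil.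
  by rewrite big_nil Rintegral_cst ?mul0r.
rewrite big_cons; case: (boolP (Q i)) => Qi.
  under eq_Rintegral do rewrite big_cons Qi.
  by rewrite RintegralD ?IH //; [exact: If|exact: L1_sum].
by under eq_Rintegral do rewrite big_cons (negbTE Qi).
Qed.

(** Domination is only required almost surely, as all the relations between
    processes are. *)
Lemma L1_le f g : measurable_fun setT f -> L1 g ->
  {ae P, forall w, `|f w| <= g w} -> L1 f.
Proof.
move=> mf Ig fg; apply/integrableP; split; first exact/measurable_EFinP.
have mg := L1_measurable Ig.
move/integrableP: Ig => [_]; apply: le_lt_trans.
apply: ae_ge0_le_integral => //.
- by apply: measurableT_comp => //; exact/measurable_EFinP.
- by apply: measurableT_comp => //; exact/measurable_EFinP.
- apply: filterS fg => w fg _; rewrite /= lee_fin (le_trans fg) //.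
  exact: ler_norm.
Qed.

Lemma L1M M f g : measurable_fun setT f -> (forall w, `|f w| <= M) -> L1 g ->
  L1 (fun w => f w * g w).
Proof.
move=> mf fM Ig; apply: (@L1_le _ (fun w => M * `|g w|)).
- by apply: measurable_funM => //; exact: L1_measurable.
- by apply: L1Z; exact: L1_norm.
- by apply: aeW => w; rewrite normrM ler_wpM2r.
Qed.

Lemma eq_E_ae f g : measurable_fun setT f -> measurable_fun setT g ->
  {ae P, forall w, f w = g w} -> E f = E g.
Proof.
move=> mf mg fg; congr fine; apply: ae_eq_integral => //.
- exact/measurable_EFinP.
- exact/measurable_EFinP.
- by apply: filterS fg => w fg _; rewrite /= fg.
Qed.

Lemma le_E f g : L1 f -> L1 g -> {ae P, forall w, f w <= g w} -> E f <= E g.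
Proof.
move=> If Ig fg; have mf := L1_measurable If; have mg := L1_measurable Ig.
have Im : L1 (fun w => Num.max (f w) (g w)).
  apply: (@L1_le _ (fun w => `|f w| + `|g w|)).
  - exact: measurable_maxr.
  - by apply: L1D; exact: L1_norm.
  - apply: aeW => w; case: (leP (f w) (g w)) => _; rewrite ?lerDr ?lerDl //.
rewrite (@eq_E_ae g (fun w => Num.max (f w) (g w))) //.
- by apply: le_Rintegral => // w _; rewrite le_max lexx.
- exact: measurable_maxr.
- by apply: filterS fg => w fg; rewrite max_r.
Qed.

Lemma E_ge0_eq0 f : L1 f -> {ae P, forall w, 0 <= f w} -> E f <= 0 ->
  {ae P, forall w, f w = 0}.
Proof.
move=> If f0 Ef; have mf := L1_measurable If.
have In := L1_norm If; have mn := L1_measurable In.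
have En : E (fun w => `|f w|) = 0.
  apply/eqP; rewrite eq_le; apply/andP; split; last exact: Rintegral_ge0.
  rewrite (@eq_E_ae (fun w => `|f w|) f) //.
  by apply: filterS f0 => w f0 /=; rewrite ger0_norm.
have f_eq0 : ae_eq P setT (EFin \o f) (cst 0%E).
  apply/ae_eq_integral_abs => //; first exact/measurable_EFinP.
  have := integrable_fin_num measurableT In.
  by move=> /fineK <-; congr _%:E.
by apply: filterS f_eq0 => w /(_ I) [].
Qed.

End RealIntegrals.

(** * Conditional expectation *)

(** The map X is the same; only the sigma-algebra of its domain grows. *)
Lemma sub_sigma_measurable {Omega : pointedType} {dE} {E : measurableType dE}
    (G H : set (set Omega)) (X : Omega -> E) : G `<=` H ->
  measurable_fun setT (X : g_sigma_algebraType G -> E) ->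
  measurable_fun setT (X : g_sigma_algebraType H -> E).
Proof. by move=> GH mX _ Y mY; exact: sub_sigma_algebra2 GH _ (mX measurableT _ mY). Qed.

Lemma measurable_bool_set {d} {T : measurableType d} (b : T -> bool) :
  measurable_fun setT b -> measurable [set x | b x].
Proof. by move=> /(_ measurableT [set true]); rewrite setTI; apply. Qed.

Section ConditionalExpectation.
Context {d : measure_display} {Omega : measurableType d} {R : realType}.
Variables (P : probability Omega R) (G : set (set Omega)).
Hypotheses (sG : sigma_algebra setT G) (Gm : G `<=` measurable).

Local Notation L1 := (integrable_rv P).
Local Notation E f := (\int[P]_w f w).
Local Notation Gfun X := (measurable_fun setT (X : g_sigma_algebraType G -> _)).

Lemma Gset_measurable (A : set Omega) : G A -> measurable (A : set (g_sigma_algebraType G)).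
Proof. exact: sub_sigma_algebra. Qed.

Lemma measurable_Gset (A : set Omega) : measurable (A : set (g_sigma_algebraType G)) -> G A.
Proof. by move=> mA; have := mA; rewrite /measurable /= sigma_algebra_id. Qed.

Lemma Gfun_measurable {dE} {E : measurableType dE} (X : Omega -> E) :
  Gfun X -> measurable_fun setT X.
Proof. by move=> mX _ Y mY; apply: Gm; apply: measurable_Gset; exact: mX. Qed.

(** The real-valued and integrable versions of [is_condE], to which the
    extended-valued ones reduce by [is_condE_condexp]. *)
Definition is_condexp (X Y : Omega -> R) :=
  [/\ Gfun Y, L1 Y & forall A, G A -> (\int[P]_(w in A) (Y w)%:E = \int[P]_(w in A) (X w)%:E)%E].

(** The charge A |-> E[X 1_A] on (Omega, G) is the image of a charge on Omega by
    the identity map; its Radon-Nikodym derivative with respect to the image of P is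
    the conditional expectation. *)
Lemma condexp_exists (X : Omega -> R) : L1 X -> exists Y, is_condexp X Y.
Proof.
move=> IX.
pose Om := g_sigma_algebraType G.
have mid : measurable_fun setT (id : Omega -> Om).
  by move=> _ A mA; rewrite setTI; apply: Gm; exact: measurable_Gset.
pose iota : {mfun Omega >-> Om} := HB.pack (id : Omega -> Om) (isMeasurableFun.Build _ _ _ _ _ mid).
pose mu := distribution P iota.
pose nu0 : {charge set Om -> \bar R} := pushforward (induced_charge IX) iota.
pose nu := nu0 mid.
have numu : nu `<< mu.
  apply/null_content_dominatesP => A mA muA; apply: null_set_integral => //.
  - exact/Gm/measurable_Gset.
  - exact/measurable_funTS/(measurable_int _ IX).
pose f := Radon_Nikodym nu mu.
have If : mu.-integrable setT f by exact: Radon_Nikodym_integrable.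
have mf : Gfun f by exact: measurable_int If.
have ffin w : f w \is a fin_num by exact: Radon_Nikodym_fin_num.
have fE w : (fine (f w))%:E = f w by rewrite fineK.
have IfP : P.-integrable setT (f : Omega -> \bar R).
  apply/integrableP; split; first exact: Gfun_measurable.
  move/integrableP: If => [_]; rewrite ge0_integral_distribution //.
  exact: measurableT_comp.
exists (fun w => fine (f w)); split.
- by apply: measurableT_comp => //.
- by apply: eq_integrable IfP => // w _; rewrite /= fE.
- move=> A GA; have mA := Gset_measurable GA.
  under eq_integral do rewrite fE.
  transitivity (nu A) => //; rewrite (Radon_Nikodym_integral numu mA).
  rewrite [RHS](integral_pushforward (mid : measurable_fun _ iota) mf) //.
  by apply: integrableS IfP => //; exact: Gm.
Qed.

Lemma integral_indicM (A : set Omega) (Z : Omega -> R) : measurable A ->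
  E (fun w => \1_A w * Z w) = \int[P]_(w in A) Z w.
Proof.
move=> mA; rewrite [RHS]Rintegral_mkcond; apply: eq_Rintegral => w _.
by rewrite patchE indicE; case: (w \in A); rewrite ?mul1r ?mul0r.
Qed.

Import HBNNSimple.

(** Approximating the factor by simple functions from below reduces the claim
    to the sets of G, by dominated convergence. *)
Lemma orthogonal_pull_out (Z g : Omega -> R) (M : R) : L1 Z ->
  (forall A, G A -> \int[P]_(w in A) Z w = 0) ->
  Gfun g -> (forall w, 0 <= g w <= M) -> E (fun w => g w * Z w) = 0.
Proof.
move=> IZ Z0 mg gM.
pose Om := g_sigma_algebraType G.
have mEg : measurable_fun setT (EFin \o (g : Om -> R)) by exact/measurable_EFinP.
(* Simple functions increasing to g. *)
pose h := nnsfun_approx measurableT mEg.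
have g0 w : [set: Om] w -> (0 <= (EFin \o (g : Om -> R)) w)%E.
  by move=> _; rewrite lee_fin; case/andP: (gM w).
have hg w : (h n w)%:E @[n --> \oo] --> (g w)%:E by exact: cvg_nnsfun_approx.
have h0 n w : 0 <= h n w by exact: fun_ge0.
have hM n w : `|h n w * Z w| <= M * `|Z w|.
  rewrite normrM ler_wpM2r // ger0_norm //.
  rewrite (le_trans _ (proj2 (andP (gM w)))) // -lee_fin nnsfun_approxE.
  exact: le_approx.
have mZ := L1_measurable IZ.
have mh n : Gfun (h n : Omega -> R) by [].
have IB (A : set Omega) : measurable A -> L1 (fun w => \1_A w * Z w).
  move=> mA; apply: (@L1M _ _ _ _ 1) => // w.
  by rewrite indicE; case: (_ \in _); rewrite ?normr1 ?normr0.
have Ih n : E (fun w => h n w * Z w) = 0.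
  have mB y : G (h n @^-1` [set y]) by exact: measurable_Gset.
  under eq_Rintegral => w _.
    rewrite fimfunE fsbig_finite //= mulr_suml.
    under eq_bigr do rewrite -mulrA.
    over.
  rewrite E_sum => [|y _]; last by apply/L1Z/IB/Gm.
  apply: big1 => y _.
  rewrite RintegralZl ?integral_indicM ?Z0 ?mulr0 //; first exact: Gm.
  exact/IB/Gm.
have mgZ : measurable_fun setT (fun w => g w * Z w).
  by apply: measurable_funM => //; exact: Gfun_measurable.
have [_ _] : [/\ P.-integrable setT (fun w => (g w * Z w)%:E),
    (\int[P]_w `|(h n w * Z w)%:E - (g w * Z w)%:E|)%E @[n --> \oo] --> 0%E &
    (\int[P]_w (h n w * Z w)%:E)%E @[n --> \oo] --> (\int[P]_w (g w * Z w)%:E)%E].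
  apply: (@dominated_convergence _ _ _ P setT measurableT
    (fun n w => (h n w * Z w)%:E) _ (fun w => (M * `|Z w|)%:E)).
  - move=> n; apply/measurable_EFinP; apply: measurable_funM => //.
    exact: Gfun_measurable.
  - exact/measurable_EFinP.
  - apply: aeW => w _; rewrite EFinM.
    by under eq_fun do rewrite EFinM; apply: cvgeZr.
  - exact/L1Z/L1_norm.
  - by apply: aeW => w n _; rewrite lee_fin.
have -> : (fun n => (\int[P]_w (h n w * Z w)%:E)%E) = fun=> 0%E.
  apply/funext => n; rewrite -[RHS]/(0%:E) -(Ih n) fineK //.
  apply: integrable_fin_num => //; apply: (@L1_le _ _ _ _ _ (fun w => M * `|Z w|)).
  - by apply: measurable_funM => //; exact: Gfun_measurable.
  - exact/L1Z/L1_norm.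
  - exact: aeW.
by move=> lim0; rewrite /Rintegral (cvg_unique _ lim0 (cvg_cst 0%E)).
Qed.

(** A bounded factor becomes nonnegative after adding the constant M, to which
    orthogonality applies as well. *)
Lemma condexp_pull_out (X Y g : Omega -> R) (M : R) : L1 X -> is_condexp X Y ->
  Gfun g -> (forall w, `|g w| <= M) ->
  E (fun w => g w * X w) = E (fun w => g w * Y w).
Proof.
move=> IX [mY IY XY] mg gM; have mg' := Gfun_measurable mg.
have IZ : L1 (fun w => X w - Y w) by exact: L1B.
have Z0 A : G A -> \int[P]_(w in A) (X w - Y w) = 0.
  move=> GA; have mA := Gm GA; rewrite RintegralB //; last 2 first.
  - exact: integrableS IX.
  - exact: integrableS IY.
  by rewrite /Rintegral XY // subrr.
have /(orthogonal_pull_out IZ Z0) : Gfun (fun w => g w + M) by exact: measurable_funD.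
have gMM w : 0 <= g w + M <= M + M by move: (gM w); rewrite ler_norml; lra.
move=> /(_ (M + M) gMM).
under eq_Rintegral => w _ do rewrite mulrDl.
have IMZ : L1 (fun w => M * (X w - Y w)) by exact: L1Z.
have IgX := L1M mg' gM IX; have IgY := L1M mg' gM IY; have IgZ := L1M mg' gM IZ.
rewrite RintegralD // RintegralZl //.
have := Z0 setT; rewrite {}(_ : \int[P]_(w in setT) _ = 0) => [_|]; last first.
  by apply: Z0; case: sG => G0 GC _; rewrite -(setD0 setT); exact: GC.
rewrite mulr0 addr0; under eq_Rintegral => w _ do rewrite mulrBr.
by rewrite RintegralB // => /subr0_eq.
Qed.

Lemma condexp_is_condE (X Y : Omega -> R) : L1 X -> is_condexp X Y ->
  is_condE P G (EFin \o X) (EFin \o Y).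
Proof.
move=> IX [mY IY XY]; split => //; last exact/measurable_EFinP.
by left; exact: integral_funepos_lt_pinfty IX.
Qed.

(** Testing on the whole space shows that Y is integrable, hence almost surely
    finite. *)
Lemma is_condE_condexp (X : Omega -> R) (Y : Omega -> \bar R) : L1 X ->
  is_condE P G (EFin \o X) Y ->
  exists2 Y', is_condexp X Y' & {ae P, forall w, Y w = (Y' w)%:E}.
Proof.
move=> IX [_ mY XY]; have mY' := Gfun_measurable mY.
have IXA A : G A -> (\int[P]_(w in A) Y w)%E \is a fin_num.
  move=> GA; rewrite XY //; apply: integrable_fin_num; first exact: Gm.
  by apply: integrableS IX => //; exact: Gm.
have IY : P.-integrable setT Y.
  apply/integrableP; split => //; apply/abse_integralP => //.
  rewrite -fin_num_abs; apply: IXA.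
  by case: sG => G0 GC _; rewrite -(setD0 setT); exact: GC.
have Yfin := integrable_ae measurableT IY.
have aeY : {ae P, forall w, Y w = (fine (Y w))%:E}.
  by apply: filterS Yfin => w /(_ I) ?; rewrite fineK.
exists (fun w => fine (Y w)) => //; split.
- exact: measurableT_comp.
- apply: le_integrable IY => //.
    by apply/measurable_EFinP; exact: Gfun_measurable (measurableT_comp _ mY).
  by move=> w _ /=; case: (Y w) => [r| |] //=; rewrite normr0 leey.
- move=> A GA; rewrite -XY //; have mA := Gm GA; apply: ae_eq_integral => //.
  + apply/measurable_EFinP/measurable_funTS; exact: measurableT_comp.
  + exact: measurable_funTS.
  + by apply: filterS aeY => w Yw _.
Qed.

(** An inequality between conditional expectations with G-measurable factors
    can be checked on the sets where the factors are bounded: the set where it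
    fails is one of them, up to a truncation, and there the opposite strict
    inequality would hold. *)
Lemma condexp_le (s r a b ma mb : Omega -> R) : L1 a -> L1 b ->
  is_condexp a ma -> is_condexp b mb -> Gfun s -> Gfun r ->
  (forall A M, G A -> (forall w, A w -> `|s w| <= M /\ `|r w| <= M) ->
    E (fun w => \1_A w * (s w * a w)) <= E (fun w => \1_A w * (r w * b w))) ->
  {ae P, forall w, s w * ma w <= r w * mb w}.
Proof.
move=> Ia Ib cma cmb ms mr sab.
have [mma Ima _] := cma; have [mmb Imb _] := cmb.
(* On each level set the factors are bounded, so they can be pulled out. *)
suff aen n : {ae P, forall w, `|s w| <= n%:R -> `|r w| <= n%:R ->
    s w * ma w <= r w * mb w}.
  apply: filterS (ae_foralln aen) => w all_n.
  have le (z : R) m : ((Num.truncn `|z|).+1 <= m)%N -> `|z| <= m%:R.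
    by move=> zm; rewrite (le_trans (ltW (truncnS_gt _))) // ler_nat.
  apply: (all_n (maxn (Num.truncn `|s w|).+1 (Num.truncn `|r w|).+1)).
    by apply: le; exact: leq_maxl.
  by apply: le; exact: leq_maxr.
pose B := [set w | `|s w| <= n%:R] `&` [set w | `|r w| <= n%:R]
  `&` [set w | r w * mb w < s w * ma w].
have GB : G B.
  apply: measurable_Gset; apply: measurableI; [apply: measurableI|];
    apply: measurable_bool_set.
  - by apply: measurable_fun_ler => //; exact: measurableT_comp.
  - by apply: measurable_fun_ler => //; exact: measurableT_comp.
  - by apply: measurable_fun_ltr => //; exact: measurable_funM.
have mB := Gm GB; have mGB := Gset_measurable GB.
have mi : Gfun (\1_B : Omega -> R) by exact: measurable_indic.
have bnd (z : Omega -> R) : (forall w, B w -> `|z w| <= n%:R) ->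
    forall w, `|\1_B w * z w| <= n%:R.
  move=> zn w; rewrite indicE; case: (boolP (w \in B)) => [|_].
    by rewrite inE mul1r => /zn.
  by rewrite mul0r normr0.
have sn := bnd s (fun w Bw => proj1 (proj1 Bw)).
have rn := bnd r (fun w Bw => proj2 (proj1 Bw)).
have msB : Gfun (fun w => \1_B w * s w) by exact: measurable_funM.
have mrB : Gfun (fun w => \1_B w * r w) by exact: measurable_funM.
have := sab B n%:R GB (fun w Bw => proj1 Bw).
under eq_Rintegral => w _ do rewrite mulrA.
under [leRHS]eq_Rintegral => w _ do rewrite mulrA.
rewrite (condexp_pull_out Ib cmb mrB rn) (condexp_pull_out Ia cma msB sn) -subr_le0.
have Isa := L1M (Gfun_measurable msB) sn Ima.
have Irb := L1M (Gfun_measurable mrB) rn Imb.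
rewrite -RintegralB // => /(E_ge0_eq0 (L1B Isa Irb)) ae0.
have {}ae0 : {ae P, forall w, \1_B w * s w * ma w - \1_B w * r w * mb w = 0}.
  apply: ae0; apply: aeW => w; rewrite indicE.
  case: (boolP (w \in B)) => [|_]; last by rewrite !mul0r subrr.
  by rewrite inE !mul1r subr_ge0 => -[_ /ltW].
apply: filterS ae0 => w; rewrite indicE => gw snw rnw.
rewrite leNgt; apply/negP => lt_w; move: gw.
by rewrite mem_set // !mul1r => /eqP; rewrite subr_eq0 gt_eqF.
Qed.

End ConditionalExpectation.

(** * Almost sure convergence and completeness *)

Section AlmostSure.
Context {d : measure_display} {Omega : measurableType d} {R : realType}.
Variable P : probability Omega R.
Local Notation L1 := (integrable_rv P).
Local Notation E f := (\int[P]_w f w).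

(** Dominated convergence for the indicators of the exceptional sets, which
    vanish eventually at almost every point. *)
Lemma ae_cvg_in_measure (X_ : nat -> Omega -> R) (e : R) : 0 < e ->
  (forall n, measurable_fun setT (X_ n)) ->
  {ae P, forall w, X_ n w @[n --> \oo] --> 0} ->
  P [set w | e < X_ n w] @[n --> \oo] --> 0%E.
Proof.
move=> e0 mX X0; pose A n := [set w | e < X_ n w].
have mA n : measurable (A n).
  by apply: measurable_bool_set; exact: measurable_fun_ltr.
have [_ _] : [/\ P.-integrable setT (cst 0%E),
    (\int[P]_w `|(\1_(A n) w)%:E - 0|)%E @[n --> \oo] --> 0%E &
    (\int[P]_w (\1_(A n) w)%:E)%E @[n --> \oo] --> (\int[P]_w (cst 0 w))%E].
  apply: (@dominated_convergence _ _ _ P setT measurableT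
    (fun n w => (\1_(A n) w)%:E) _ (cst 1%E)).
  - by move=> n; apply/measurable_EFinP; exact: measurable_indic.
  - exact: measurable_cst.
  - apply: filterS X0 => w X0w _; apply: cvg_near_cst.
    move/cvgrPdist_lt: X0w => /(_ e e0) [n0 _ n0P]; exists n0 => // n /n0P /=.
    rewrite sub0r normrN => Xe; rewrite indicE memNset //= => /(lt_trans Xe).
    by rewrite ltNge ler_norm.
  - exact: finite_measure_integrable_cst.
  - by apply: aeW => w n _; rewrite indicE /= lee_fin ger0_norm // lern1 leq_b1.
rewrite integral0 => lim0; rewrite (_ : (fun n => _) =
    (fun n => \int[P]_w (\1_(A n) w)%:E)%E) //.
by apply/funext => n; rewrite integral_indic // setIT.
Qed.

(** Fatou's lemma in the form needed for norms: almost sure limits do not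
    increase a bound on the expectations. *)
Lemma fatou_L1 (f_ : nat -> Omega -> R) (f : Omega -> R) (e : R) :
  (forall n, L1 (f_ n)) -> (forall n w, 0 <= f_ n w) -> (forall n, E (f_ n) <= e) ->
  measurable_fun setT f -> (forall w, 0 <= f w) ->
  {ae P, forall w, f_ n w @[n --> \oo] --> f w} -> L1 f /\ E f <= e.
Proof.
move=> If_ f_0 Ef_ mf f0 f_f.
have mf_ n : measurable_fun setT (fun w => (f_ n w)%:E).
  by apply/measurable_EFinP; exact: L1_measurable (If_ n).
have le_e : (\int[P]_w (f w)%:E <= e%:E)%E.
  rewrite (@ae_eq_integral _ _ _ P setT (fun w => limn_einf (fun n => (f_ n w)%:E))) //.
  - have f_ge0 n (w : Omega) : setT w -> (0 <= (f_ n w)%:E)%E by rewrite lee_fin.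
    apply: le_trans (fatou P measurableT mf_ f_ge0) _.
    rewrite limn_einf_lim; apply: lime_le; first exact: is_cvg_einfs.
    apply: nearW => n; apply: le_trans (_ : _ <= \int[P]_w (f_ n w)%:E)%E _.
      by apply: ereal_inf_lbound; exists n => /=.
    by rewrite -[leLHS]fineK ?lee_fin; [exact: Ef_|exact: integrable_fin_num (If_ n)].
  - exact/measurable_EFinP.
  - have -> : (fun w => limn_einf (fun n => (f_ n w)%:E)) =
        (fun w => - limn_esup (fun n => - (f_ n w)%:E))%E.
      apply/funext => w; rewrite -limn_einfN.
      have -> // : (fun n => (f_ n w)%:E) = -%E \o (fun n => - (f_ n w)%:E)%E.
      by apply/funext => n /=; rewrite opprK.
    apply: measurableT_comp => //; apply: measurable_fun_limn_esup => n.
    exact: measurableT_comp.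
  - apply: filterS f_f => w fw _.
    have /cvg_limn_einf_sup[-> _] // : (f_ n w)%:E @[n --> \oo] --> (f w)%:E.
    exact: cvg_comp fw _.
have If : L1 f.
  apply/integrableP; split; first exact/measurable_EFinP.
  rewrite (le_lt_trans _ (ltry e)) //; apply: le_trans le_e.
  apply: ge0_le_integral => //.
  - by apply: measurableT_comp => //; exact/measurable_EFinP.
  - exact/measurable_EFinP.
  - by move=> w _ /=; rewrite ger0_norm.
by split => //; rewrite -lee_fin fineK //; exact: integrable_fin_num If.
Qed.

(** The argument of the Riesz-Fischer theorem. The limit is defined
    pointwise by an upper limit, which keeps it measurable for the sub-sigma-algebra
    that makes the terms measurable. *)
Lemma fast_cauchy_ae_cvg (G : set (set Omega)) (g_ : nat -> Omega -> R) (r : Omega -> R) :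
  (forall n, measurable_fun setT (g_ n : g_sigma_algebraType G -> R)) ->
  (forall w, 0 < r w) ->
  (forall n, L1 (fun w => r w * (g_ n.+1 w - g_ n w) ^+ 2)) ->
  (forall n, E (fun w => r w * (g_ n.+1 w - g_ n w) ^+ 2) <= 4^-1 ^+ n) ->
  exists2 g, measurable_fun setT (g : g_sigma_algebraType G -> R) &
    {ae P, forall w, g_ n w @[n --> \oo] --> g w}.
Proof.
move=> mg r0 Ig Eg.
pose lim_g w := limn_esup (fun n => (g_ n w)%:E).
exists (fun w => fine (lim_g w)).
  apply: measurableT_comp => //; apply: measurable_fun_limn_esup => n.
  exact/measurable_EFinP.
suff : {ae P, forall w, cvgn (fun n => g_ n w)}.
  apply: filterS => w gw; rewrite /lim_g.
  have /cvg_limn_einf_sup[_ ->] // : (g_ n w)%:E @[n --> \oo] --> (limn (g_ ^~ w))%:E.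
  exact: cvg_comp gw _.
(* The factor 2^n keeps the series summable, and with 2|y| <= 2^-n + 2^n y^2 it
   turns summability of the squares into absolute summability. *)
pose phi n w := 2 ^+ n * (r w * (g_ n.+1 w - g_ n w) ^+ 2).
have phi0 n w : 0 <= phi n w.
  by apply: mulr_ge0; [exact: exprn_ge0|apply: mulr_ge0; [exact: ltW|exact: sqr_ge0]].
have Iphi n : L1 (phi n) by exact: L1Z.
have mphi n : measurable_fun setT (fun w => (phi n w)%:E).
  by apply/measurable_EFinP; exact: L1_measurable (Iphi n).
pose Phi w := (\sum_(n <oo) (phi n w)%:E)%E.
have mPhi : measurable_fun setT Phi.
  by apply: ge0_emeasurable_sum => // n w _ _; rewrite lee_fin.
have IPhi : P.-integrable setT Phi.
  apply/integrableP; split => //.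
  under eq_integral do (rewrite gee0_abs; last by apply: nneseries_ge0 => n _ _; rewrite lee_fin).
  rewrite integral_nneseries //; last by move=> n w _; rewrite lee_fin.
  apply: (@le_lt_trans _ _ (\sum_(n <oo) (2 / (2 ^ (n + 1))%:R)%:E)%E); last first.
    by rewrite (cvg_lim _ (@cvg_geometric_eseries_half R 2 0)) // ltry.
  apply: lee_nneseries => [n _ _|n _]; first by apply: integral_ge0 => w _; rewrite lee_fin.
  rewrite -[leLHS]fineK; last exact: integrable_fin_num (Iphi n).
  rewrite lee_fin; apply: (@le_trans _ _ (2 ^+ n * 4^-1 ^+ n)).
    rewrite -[leLHS]/(E (phi n)) RintegralZl //; last exact: Ig.
    by apply: ler_wpM2l; [exact: exprn_ge0|exact: Eg].
  rewrite -exprMn addn1 natrX exprS invfM mulrA divff // mul1r -exprVn.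
  by rewrite (_ : 2 * 4^-1 = 2^-1 :> R) //; lra.
apply: filterS (integrable_ae measurableT IPhi) => w /(_ I) Phi_fin.
pose M := fine (Phi w).
have phi_le n : \sum_(0 <= k < n) phi k w <= M.
  rewrite -lee_fin /M fineK // -sumEFin.
  by apply: nneseries_lim_ge => k _ _; rewrite lee_fin.
have bound n : \sum_(0 <= k < n) `|g_ k.+1 w - g_ k w| <= 2 + M / r w.
  apply: (@le_trans _ _ (\sum_(0 <= k < n) (2^-1 ^+ k + (r w)^-1 * phi k w))).
    apply: ler_sum => k _; set y := g_ k.+1 w - g_ k w.
    have -> : (r w)^-1 * phi k w = 2 ^+ k * y ^+ 2.
      by rewrite /phi -/y; field; rewrite gt_eqF.
    have p0 : 0 < 2 ^+ k :> R by rewrite exprn_gt0.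
    rewrite exprVn -(ler_pM2l p0) mulrDr divff ?gt_eqF //.
    rewrite -[y ^+ 2]real_normK ?num_real //.
    have := sqr_ge0 (2 ^+ k * `|y| - 1); have := normr_ge0 y; nra.
  rewrite big_split -mulr_sumr; apply: lerD.
    have -> : \sum_(0 <= k < n) 2^-1 ^+ k = 2 - 2 * 2^-1 ^+ n :> R.
      elim: n => [|n IH]; first by rewrite big_nil expr0; lra.
      by rewrite big_nat_recr //= IH exprS; lra.
    by rewrite gerBl mulr_ge0 // exprn_ge0 // invr_ge0.
  by rewrite mulrC ler_pM2r ?invr_gt0.
have /normed_cvg : cvgn [normed series (telescope (g_ ^~ w))].
  apply: nondecreasing_is_cvgn.
    by apply: nondecreasing_series => k _ _ /=; exact: normr_ge0.
  by exists (2 + M / r w) => _ [n _ <-]; exact: bound.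
move=> cvg_tel; rewrite (_ : (fun n => g_ n w) =
    (fun n => g_ 0%N w + series (telescope (g_ ^~ w)) n)).
  by apply: is_cvgD => //; exact: is_cvg_cst.
by apply/funext => n; exact: eq_sum_telescope.
Qed.

End AlmostSure.

(** * Projection onto a convex cone *)

(** Projection of h on a convex cone C for the quadratic form N with polar form B,
    defined on a linear set H. Completeness is only required of fast Cauchy
    sequences in C, in the form of lower semicontinuity of the distance to h: the
    limit p is not farther from h than the sequence eventually is. The two
    conclusions are the first-order conditions of the minimum in the directions
    v and - p. *)
Lemma cone_projection (R : realType) (V : lmodType R) (H C : set V)
    (N : V -> R) (B : V -> V -> R) (h : V) :
  H h -> C `<=` H -> C 0 ->
  (forall u v c, H u -> H v -> H (u + c *: v)) ->
  (forall u v c, 0 <= c -> C u -> C v -> C (u + c *: v)) ->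
  (forall v, H v -> 0 <= N v) ->
  (forall u v c, H u -> H v -> N (u + c *: v) = N u + 2 * c * B u v + c ^+ 2 * N v) ->
  (forall (u_ : nat -> V) e, (forall n, C (u_ n)) -> (forall n, N (h - u_ n) <= e) ->
     (forall n, N (u_ n.+1 - u_ n) <= 4^-1 ^+ n) ->
     exists2 p, C p & forall a n0, (forall n, (n0 <= n)%N -> N (h - u_ n) <= a) ->
       N (h - p) <= a) ->
  exists p, [/\ C p, forall v, C v -> B (h - p) v <= 0 & 0 <= B (h - p) p].
Proof.
move=> Hh CH C0 Hlin Ccone N0 Nexp complete.
have Cscale c v : 0 <= c -> C v -> C (c *: v).
  by move=> c0 Cv; rewrite -[_ *: _]add0r; exact: Ccone.
have HB u v : H u -> H v -> H (u - v).
  by move=> Hu Hv; rewrite -scaleN1r; exact: Hlin.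
pose D := [set N (h - v) | v in C].
have infD : has_inf D.
  split; first by exists (N (h - 0)), 0.
  by exists 0 => _ [v Cv <-]; apply/N0/HB => //; exact: CH.
pose delta := inf D.
have delta_le v : C v -> delta <= N (h - v).
  by move=> Cv; apply: ge_inf; [exact: infD.2|exists v].
pose eps n : R := 4^-1 ^+ n / 4.
have eps0 n : 0 < eps n by rewrite /eps divr_gt0 // exprn_gt0 // invr_gt0.
have /choice [u_ u_P] : forall n, exists v, C v /\ N (h - v) < delta + eps n.
  move=> n; have [_ [v Cv <-] vd] := inf_adherent (eps0 n) infD.
  by exists v.
have Cu n : C (u_ n) := proj1 (u_P n).
have eps_le m n : (m <= n)%N -> eps n <= eps m.
  move=> mn; rewrite /eps ler_pM2r ?invr_gt0 //.
  by rewrite ler_wiXn2l // ?invr_ge0 // invf_le1 // ler1n.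
have near_u m n : (m <= n)%N -> N (h - u_ n) <= delta + eps m.
  by move=> mn; have := (u_P n).2; have := eps_le _ _ mn; lra.
(* The parallelogram identity: the midpoint of u and v is in C, hence at
   least as far from h as delta. *)
have Nz u v : C u -> C v -> N (v - u) <= 2 * N (h - u) + 2 * N (h - v) - 4 * delta.
  move=> Cu' Cv; have Hu := HB _ _ Hh (CH _ Cu').
  have Hz := HB _ _ (CH _ Cv) (CH _ Cu').
  have Nb : N (h - v) = N (h - u) + 2 * -1 * B (h - u) (v - u) + (-1) ^+ 2 * N (v - u).
    rewrite -(Nexp _ _ (-1) Hu Hz); congr N.
    by rewrite scaleN1r opprB addrC addrA subrK addrC.
  pose c : R := 2^-1; have c0 : 0 <= c by rewrite invr_ge0.
  have cu : c *: u - u = - (c *: u).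
    have -> : c *: u - u = (c - 1) *: u by rewrite scalerBl scale1r.
    by rewrite -scaleNr; congr (_ *: _); rewrite /c; lra.
  have := delta_le (c *: u + c *: v) (Ccone _ _ _ c0 (Cscale _ _ c0 Cu') Cv).
  rewrite (_ : h - _ = (h - u) + (- c) *: (v - u)); last first.
    by rewrite scaleNr scalerBr opprB -addrA; congr (_ + _); rewrite addrA [- u + _]addrC cu -opprD.
  rewrite (Nexp _ _ _ Hu Hz) Nb /c; lra.
have fast n : N (u_ n.+1 - u_ n) <= 4^-1 ^+ n.
  have := Nz _ _ (Cu n) (Cu n.+1); have := (u_P n).2; have := (u_P n.+1).2.
  by have := eps_le _ _ (leqnSn n); rewrite /eps; lra.
have [p Cp p_min] := complete u_ _ Cu (fun n => near_u _ _ (leq0n n)) fast.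
have p_delta : N (h - p) <= delta.
  apply/ler_addgt0Pr => e e0.
  have [n0 n0e] : exists n0, eps n0 <= e.
    exists (Num.truncn e^-1); set k := Num.truncn _.
    have k4 : e^-1 <= 4 ^+ k.
      rewrite (le_trans (ltW (truncnS_gt _))) // -/k -natrX ler_nat; exact: ltn_expl.
    have e4 : 4^-1 ^+ k <= e by rewrite exprVn invf_ple // posrE exprn_gt0.
    by have := exprn_gt0 k (_ : 0 < 4^-1 :> R); rewrite /eps; lra.
  by apply: (p_min _ n0) => n /near_u; have := n0e; lra.
have Hp := CH _ Cp; have Hf := HB _ _ Hh Hp.
exists p; split => // [v Cv|].
  have Hv := CH _ Cv; have Nv := N0 _ Hv.
  rewrite leNgt; apply/negP => B0.
  (* Moving from p by c v decreases the distance for this c. *)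
  pose c := B (h - p) v / (N v + 1).
  have c0 : 0 < c by rewrite divr_gt0 //; lra.
  have := delta_le _ (Ccone _ _ _ (ltW c0) Cp Cv).
  rewrite opprD addrA -scaleNr (Nexp _ _ _ Hf Hv) sqrrN.
  have cN : c * (N v + 1) = B (h - p) v by rewrite /c mulrVK // unitfE; lra.
  have := mulr_ge0 (ltW c0) Nv.
  nra.
have Np := N0 _ Hp.
rewrite leNgt; apply/negP => B0.
(* Here p is replaced with (1 - c) p, which is in C because c <= 1. *)
pose c := - B (h - p) p / (N p - B (h - p) p + 1).
have c0 : 0 < c by rewrite divr_gt0 //; lra.
have cN : c * (N p - B (h - p) p + 1) = - B (h - p) p.
  by rewrite /c mulrVK // unitfE; lra.
have c1 : 0 <= 1 - c by nra.
have := delta_le _ (Cscale _ _ c1 Cp).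
rewrite (_ : h - _ = (h - p) + c *: p); last first.
  by rewrite scalerBl scale1r opprB [c *: p - p]addrC addrA.
rewrite (Nexp _ _ _ Hf Hp); nra.
Qed.

(** * Abel summation and the solvency cone *)

(** Summation by parts for prices a and holdings U, where U 0 is held before date 0
    and U t.+1 at date t: each transfer is paired with the sum of the prices from
    its date on. *)
Lemma abel_summation (R : comRingType) (T : nat) (U : nat -> R) (a : 'I_T.+1 -> R) :
  \sum_(t < T.+1) a t * U t.+1 =
  U 0%N * (\sum_(t < T.+1) a t) +
  \sum_(t < T.+1) (U t.+1 - U t) * (\sum_(s < T.+1 | (t <= s)%N) a s).
Proof.
under [X in _ + X]eq_bigr do rewrite big_distrr /=.
rewrite (exchange_big_dep predT) //= big_distrr -big_split /=.
apply: eq_bigr => s _; rewrite -big_distrl -mulrDl mulrC; congr (_ * _).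
rewrite -(big_ord_widen T.+1 (fun t => U t.+1 - U t) (ltn_ord s)).
by rewrite -(big_mkord predT (fun t => U t.+1 - U t)) telescope_sumr // addrC subrK.
Qed.

Section Solvency.
Context {d : measure_display} {Omega : measurableType d} {R : realType} {T : nat}.
Variables (mu lambda : R) (S : process T Omega R).
Hypotheses (mu01 : 0 < mu < 1) (lambda01 : 0 < lambda < 1).
Local Notation K := (solvency mu lambda S).

(** With a positive price the cone is the intersection of two half-planes, one for
    each rate at which the second asset can be traded. *)
Lemma solvencyP t w (x : R * R) : 0 < S t w -> K t w x <->
  0 <= x.1 + S t w * (1 - mu) * x.2 /\ 0 <= x.1 + S t w * (1 + lambda) * x.2.
Proof.
move: mu01 lambda01 => /andP[mu0 mu1] /andP[la0 la1] S0; rewrite /solvency /=.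
have [x0|x0] := leP 0 x.2; rewrite /= ?mulr1 ?mulr0 ?addr0 ?add0r.
  have : 0 <= S t w * (mu + lambda) * x.2 by apply: mulr_ge0 => //; apply: mulr_ge0; lra.
  by split=> [|[]]; [split|]; lra.
have : 0 <= S t w * (mu + lambda) * - x.2.
  by apply: mulr_ge0; [apply: mulr_ge0|]; lra.
by split=> [|[]]; [split|]; lra.
Qed.

Lemma solvencyD t w (x y : R * R) : 0 < S t w -> K t w x -> K t w y -> K t w (x + y).
Proof.
by move=> S0 /(solvencyP _ S0)[x1 x2] /(solvencyP _ S0)[y1 y2];
  apply/(solvencyP _ S0); split => /=; lra.
Qed.

Lemma solvencyZ t w (c : R) (x : R * R) : 0 < S t w -> 0 <= c -> K t w x ->
  K t w (c *: x).
Proof.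
move=> S0 c0 /(solvencyP _ S0)[x1 x2]; apply/(solvencyP _ S0).
by have := mulr_ge0 c0 x1; have := mulr_ge0 c0 x2; rewrite /= /GRing.scale /=; split; lra.
Qed.

Lemma solvency0 t w : K t w 0.
Proof. by rewrite /solvency /= !mulr0 !mul0r addr0 mulr0 addr0. Qed.

Lemma solvency_ge0 t w (x : R * R) : 0 < S t w -> 0 <= x.1 -> 0 <= x.2 -> K t w x.
Proof.
move: mu01 lambda01 => /andP[mu0 mu1] /andP[la0 la1] S0 x1 x2.
apply/(solvencyP _ S0); split; apply: addr_ge0 => //; apply: mulr_ge0 => //; apply: mulr_ge0; lra.
Qed.

End Solvency.

(** * Weak duality *)

Section Market.
Context {d : measure_display} {Omega : measurableType d} {R : realType}.
Variables (P : probability Omega R) (T : nat) (F : 'I_T.+1 -> set (set Omega)).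
Hypothesis filtF : filtration P F.
Variables (mu lambda : R) (S : process T Omega R).
Hypotheses (mu01 : 0 < mu < 1) (lambda01 : 0 < lambda < 1).
Hypothesis S_gt0 : forall t, {ae P, forall w, 0 < S t w}.
Local Notation K := (solvency mu lambda S).
Local Notation L1 := (integrable_rv P).
Local Notation E f := (\int[P]_w f w).
Local Notation Fmeas t X := (measurable_fun setT (X : g_sigma_algebraType (F t) -> _)).

Lemma F_sigma t : sigma_algebra setT (F t). Proof. by case: filtF. Qed.

Lemma F_measurable t : F t `<=` measurable.
Proof. by case: filtF => _ mono <- _; apply: mono; rewrite -ltnS ltn_ord. Qed.

Lemma Fmeas_measurable {dE} {D : measurableType dE} t (X : Omega -> D) :
  Fmeas t X -> measurable_fun setT X.
Proof. exact: (Gfun_measurable (F_sigma t) (@F_measurable t)). Qed.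

Lemma Fmeas_le {dE} {D : measurableType dE} (s t : 'I_T.+1) (X : Omega -> D) :
  (s <= t)%N -> Fmeas s X -> Fmeas t X.
Proof. by case: filtF => _ mono _ _ st; apply: sub_sigma_measurable; exact: mono. Qed.

Lemma Fmeas_pair t (X : Omega -> R * R) :
  Fmeas t X <-> Fmeas t (fun w => (X w).1) /\ Fmeas t (fun w => (X w).2).
Proof. exact: measurable_fun_pairP. Qed.

Lemma ae_all (A : 'I_T.+1 -> Omega -> Prop) :
  (forall t, {ae P, forall w, A t w}) -> {ae P, forall w t, A t w}.
Proof. exact: filter_forall. Qed.

Definition remaining (q : process T Omega R) (t : 'I_T.+1) (w : Omega) : R :=
  \sum_(s < T.+1 | (t <= s)%N) q s w.

(** The weak form of the statement that the conditional expectations of a and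
    b given F_t form a vector of the dual cone of K_t. *)
Definition dual_pair (t : 'I_T.+1) (a b : Omega -> R) : Prop :=
  forall (eta : Omega -> R * R) (M : R), Fmeas t eta ->
    (forall w, `|(eta w).1| <= M /\ `|(eta w).2| <= M) ->
    {ae P, forall w, K t w (eta w)} ->
    0 <= E (fun w => (eta w).1 * a w + (eta w).2 * b w).

(** The processes q and p are the prices of the two assets: at each date they are
    nonnegative on solvent positions, and their future sums are dual pairs. *)
Definition consistent_prices (q p : process T Omega R) : Prop :=
  [/\ forall t, L1 (q t), forall t, L1 (p t),
      forall t, {ae P, forall w, forall x, K t w x ->
        0 <= q t w * x.1 + p t w * x.2} &
      forall t, dual_pair t (remaining q t) (remaining p t)].

Lemma L1_remaining q t : (forall s, L1 (q s)) -> L1 (remaining q t).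
Proof. by move=> Iq; exact: L1_sum. Qed.

Fixpoint all_before (B : nat -> Omega -> bool) (k : nat) (w : Omega) : bool :=
  if k is k'.+1 then all_before B k' w && B k' w else true.

Section Stopping.
Variables (q p : process T Omega R) (xi : process T Omega (R * R)) (x : R * R).
Hypotheses (qp : consistent_prices q p) (xi_adapted : L0 F xi).
Hypothesis xiK : forall t, {ae P, forall w, K t w (- xi t w)}.

(** The holdings before the transfer of date k, so that [position t.+1] is the
    wealth at date t; the integer index gives room for the initial value x. *)
Definition position (k : nat) (w : Omega) : R * R :=
  x + \sum_(s < T.+1 | (s < k)%N) xi s w.

Hypothesis positionK : forall t : 'I_T.+1, {ae P, forall w, K t w (position t.+1 w)}.

Lemma position_rec (t : 'I_T.+1) w : position t.+1 w = position t w + xi t w.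
Proof.
rewrite /position -addrA; congr (_ + _).
rewrite (bigD1 t) //= addrC; congr (_ + _); apply: eq_bigl => s.
by rewrite ltnS ltn_neqAle andbC.
Qed.

Lemma position_Fmeas (t : 'I_T.+1) k : (k <= t.+1)%N -> Fmeas t (position k).
Proof.
move=> kt.
have xis (s : 'I_T.+1) : (s < k)%N -> Fmeas t (xi s).
  by move=> sk; apply: (@Fmeas_le _ _ s); [rewrite -ltnS (leq_trans sk)|exact: xi_adapted].
pose part (f : R * R -> R) w := \sum_(s < T.+1) (if (s < k)%N then f (xi s w) else 0).
have -> : position k = fun w => (x.1 + part fst w, x.2 + part snd w).
  apply/funext => w; apply/pair_equal_spec.
  by split; rewrite /= raddf_sum /= big_mkcond.
apply/Fmeas_pair; split; apply: measurable_funD => //; apply: measurable_sum => s;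
  by case: (ltnP s k) => [/xis/Fmeas_pair[]|_]; last exact: measurable_cst.
Qed.

Section Level.
Variable n : nat.

(** The position has stayed in the box of size n before date k. The initial
    position is not tested. *)
Definition alive := all_before (fun k w =>
  (`|(position k.+1 w).1| <= n%:R) && (`|(position k.+1 w).2| <= n%:R)).

Definition stopped (k : nat) (w : Omega) : R * R :=
  if alive k w then position k w else 0.

Lemma alive_Fmeas (t : 'I_T.+1) k : (k <= t.+1)%N -> Fmeas t (alive k).
Proof.
elim: k => [|k IH] kt; first exact: measurable_cst.
have /Fmeas_pair[m1 m2] := position_Fmeas kt.
apply: measurable_and; first exact: IH (ltnW kt).
by apply: measurable_and; apply: measurable_fun_ler => //; exact: measurableT_comp.
Qed.

Lemma stopped_Fmeas (t : 'I_T.+1) k : (k <= t.+1)%N -> Fmeas t (stopped k).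
Proof.
by move=> kt; apply: measurable_fun_ifT;
  [exact: alive_Fmeas|exact: position_Fmeas|exact: measurable_cst].
Qed.

Let M : R := n%:R + (`|x.1| + `|x.2|).

(** The summand |x^1| + |x^2| covers the initial position. *)
Lemma stopped_bounded k w : `|(stopped k w).1| <= M /\ `|(stopped k w).2| <= M.
Proof.
have n0 : 0 <= n%:R :> R by []. have x1 := normr_ge0 x.1; have x2 := normr_ge0 x.2.
rewrite /stopped; case: ifPn => [|_]; last by rewrite /= normr0 /M; split; lra.
case: k => [_|k /= /andP[_ /andP[b1 b2]]]; last by rewrite /M; split; lra.
rewrite /position big_pred0 // addr0 /M; split; lra.
Qed.

Lemma stopped0 w : stopped 0 w = x.
Proof. by rewrite /stopped /= /position big_pred0 // addr0. Qed.

(** Three cases. While the position stays in the box the transfer is the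
    original one. On leaving it the whole position [position t] is given up; it
    is solvent at date t as the sum of the solvent [position t.+1] and
    - xi t. Afterwards there is no transfer. *)
Lemma stopped_step t : {ae P, forall w, K t w (stopped t w - stopped t.+1 w)}.
Proof.
move: (S_gt0 t) (xiK t) (positionK t); apply: filterS3 => w S0 xw pw.
have step : position t w = position t.+1 w - xi t w by rewrite position_rec addrK.
have : alive t.+1 w -> alive t w by case/andP.
rewrite /stopped; case: (alive t w) => [|]; case: (alive t.+1 w) => [alive_le|alive_le].
- by rewrite position_rec opprD addNKr.
- by rewrite subr0 step; exact: solvencyD.
- by have := alive_le isT.
- by rewrite subrr; exact: solvency0.
Qed.

(** The stopped transfers are bounded, so they can be tested against the dual pairs
    of future prices. *)
Lemma E_stopped_le :
  E (fun w => \sum_(t < T.+1) (q t w * (stopped t.+1 w).1 + p t w * (stopped t.+1 w).2)) <=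
  x.1 * E (fun w => \sum_(t < T.+1) q t w) + x.2 * E (fun w => \sum_(t < T.+1) p t w).
Proof.
have [Iq Ip _ weak] := qp.
have mstop (t : 'I_T.+1) k : (k <= t.+1)%N ->
    measurable_fun setT (fun w => (stopped k w).1) /\
    measurable_fun setT (fun w => (stopped k w).2).
  by move=> /stopped_Fmeas/Fmeas_measurable/measurable_fun_pairP.
have b1 k w := proj1 (stopped_bounded k w); have b2 k w := proj2 (stopped_bounded k w).
pose eta t w := stopped t w - stopped t.+1 w.
have meta (t : 'I_T.+1) : Fmeas t (eta t).
  have /Fmeas_pair[m1 m2] := stopped_Fmeas (leqnSn t).
  have /Fmeas_pair[m3 m4] := stopped_Fmeas (leqnn t.+1).
  by apply/Fmeas_pair; split; apply: measurable_funB.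
have beta (t : 'I_T.+1) w : `|(eta t w).1| <= M + M /\ `|(eta t w).2| <= M + M.
  by split; apply: (le_trans (ler_normB _ _)); apply: lerD.
pose gain (t : 'I_T.+1) w := (eta t w).1 * remaining q t w + (eta t w).2 * remaining p t w.
have Igain (t : 'I_T.+1) : L1 (gain t).
  have /Fmeas_measurable/measurable_fun_pairP[m1 m2] := meta t.
  apply: L1D; (apply: (@L1M _ _ _ _ (M + M)) => //; last exact: L1_remaining) => w;
    by have [] := beta t w.
have Isum q' : (forall t, L1 (q' t)) -> L1 (fun w => \sum_(t < T.+1) q' t w).
  by move=> Iq'; apply: L1_sum.
have -> : (fun w => \sum_(t < T.+1) (q t w * (stopped t.+1 w).1 + p t w * (stopped t.+1 w).2)) =
  (fun w => (x.1 * (\sum_(t < T.+1) q t w) + x.2 * (\sum_(t < T.+1) p t w))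
    - \sum_(t < T.+1) gain t w).
  apply/funext => w; rewrite big_split /=.
  rewrite (abel_summation (fun k => (stopped k w).1)).
  rewrite (abel_summation (fun k => (stopped k w).2)) stopped0.
  rewrite addrACA; congr (_ + _); rewrite -big_split -sumrN; apply: eq_bigr => t _ /=.
  rewrite /gain /eta /remaining /=; ring.
have Ix : L1 (fun w => x.1 * (\sum_(t < T.+1) q t w) + x.2 * (\sum_(t < T.+1) p t w)).
  by apply: L1D; apply: L1Z; exact: Isum.
rewrite RintegralB //; last exact: Isum.
rewrite RintegralD ?RintegralZl //; [|exact: Isum..|exact/L1Z/Isum|exact/L1Z/Isum].
rewrite lerBlDr lerDl E_sum //; apply: sumr_ge0 => t _.
apply: (weak t (eta t) (M + M)) => //; exact: stopped_step.
Qed.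

End Level.

Lemma alive_le n k j w : (j <= k)%N -> alive n k w -> alive n j w.
Proof.
elim: k => [|k IH]; first by rewrite leqn0 => /eqP->.
by rewrite leq_eqVlt ltnS => /orP[/eqP->//|/IH jk] /andP[/jk].
Qed.

Lemma alive_level n m k w : (n <= m)%N -> alive n k w -> alive m k w.
Proof.
move=> nm; elim: k => [//|k IH] /andP[ak /andP[b1 b2]].
have nmR : n%:R <= m%:R :> R by rewrite ler_nat.
apply/andP; split; first exact: IH.
by apply/andP; split; [exact: le_trans b1 _|exact: le_trans b2 _].
Qed.

Lemma alive_exists k w : exists n, alive n k w.
Proof.
elim: k => [|k [n an]]; first by exists 0%N.
set y := position k.+1 w.
exists (maxn n (maxn (Num.truncn `|y.1|).+1 (Num.truncn `|y.2|).+1)).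
apply/andP; split; first by apply: alive_level an; exact: leq_maxl.
have le (z : R) m : ((Num.truncn `|z|).+1 <= m)%N -> `|z| <= m%:R.
  by move=> zm; rewrite (le_trans (ltW (truncnS_gt _))) // ler_nat.
by apply/andP; split; apply: le; rewrite !leq_max leqnn !orbT.
Qed.

(** The gain of the stopped portfolio is the gain G on the event that the position
    never leaves the box, and is nonnegative elsewhere; these events exhaust
    Omega as the box grows. *)
Lemma position_gain (G : Omega -> R) :
  G = (fun w => \sum_(t < T.+1)
     (q t w * (position t.+1 w).1 + p t w * (position t.+1 w).2)) ->
  L1 G /\
  E G <= x.1 * E (fun w => \sum_(t < T.+1) q t w) + x.2 * E (fun w => \sum_(t < T.+1) p t w).
Proof.
move=> GE; set kappa := _ + _.
have [Iq Ip pos_qp _] := qp.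
have mpos (t : 'I_T.+1) : measurable_fun setT (fun w => (position t.+1 w).1) /\
    measurable_fun setT (fun w => (position t.+1 w).2).
  by have /Fmeas_measurable/measurable_fun_pairP := position_Fmeas (leqnn t.+1).
have mG : measurable_fun setT G.
  rewrite GE; apply: measurable_sum => t; have [m1 m2] := mpos t.
  by apply: measurable_funD; apply: measurable_funM => //; exact: L1_measurable.
have G0 : {ae P, forall w, 0 <= G w}.
  apply: filterS2 (ae_all pos_qp) (ae_all positionK) => w qpw posw.
  by rewrite GE; apply: sumr_ge0 => t _; exact: qpw.
pose H w := Num.max (G w) 0.
have mH : measurable_fun setT H by exact: measurable_maxr.
have H0 w : 0 <= H w by rewrite le_max lexx orbT.
pose A n := [set w | alive n T.+1 w].
have mA n : measurable (A n).
  apply: measurable_bool_set; apply: (@Fmeas_measurable _ _ ord_max).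
  exact: alive_Fmeas.
pose Z n w := \sum_(t < T.+1) (q t w * (stopped n t.+1 w).1 + p t w * (stopped n t.+1 w).2).
have IZ n : L1 (Z n).
  apply: L1_sum => t _.
  have /Fmeas_measurable/measurable_fun_pairP[m1 m2] := stopped_Fmeas n (leqnn t.+1).
  under [X in L1 X]eq_fun do rewrite mulrC [X in _ + X]mulrC.
  by apply: L1D; apply: L1M => // w; [exact: (stopped_bounded n t.+1 w).1|
                                       exact: (stopped_bounded n t.+1 w).2].
have Z0 n : {ae P, forall w, 0 <= Z n w}.
  apply: filterS2 (ae_all pos_qp) (ae_all positionK) => w qpw posw.
  apply: sumr_ge0 => t _; rewrite /stopped; case: ifPn => _; first exact: qpw.
  by rewrite !mulr0 addr0.
have leA n : (\int[P]_(w in A n) (H w)%:E <= kappa%:E)%E.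
  apply: (@le_trans _ _ (\int[P]_w (Num.max (Z n w) 0)%:E)%E).
    rewrite integral_mkcond; apply: ge0_le_integral => //.
    - by move=> w _; rewrite patchE; case: ifP => // _; rewrite lee_fin.
    - apply/measurable_restrict => //; apply/measurable_funTS/measurable_EFinP.
      exact: mH.
    - apply/measurable_EFinP; apply: measurable_maxr => //; exact: L1_measurable.
    - move=> w _; rewrite patchE; case: ifPn => [|_]; last first.
        by rewrite lee_fin le_max lexx orbT.
      rewrite inE => Aw; rewrite lee_fin /H (_ : G w = Z n w) // GE.
      by apply: eq_bigr => t _; rewrite /stopped (alive_le _ Aw).
  have EZ : E (Z n) <= kappa by exact: E_stopped_le.
  rewrite (@ae_eq_integral _ _ _ P setT (EFin \o Z n)) //.
  - rewrite -[leLHS]fineK ?lee_fin //; exact: integrable_fin_num (IZ n).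
  - by apply/measurable_EFinP; apply: measurable_maxr => //; exact: L1_measurable.
  - by apply/measurable_EFinP; exact: L1_measurable.
  - by apply: filterS (Z0 n) => w Zw _ /=; rewrite max_l.
have leH : (\int[P]_w (H w)%:E <= kappa%:E)%E.
  have AT : \bigcup_n A n = [set: Omega].
    apply/seteqP; split => // w _.
    by have [n an] := alive_exists T.+1 w; exists n.
  have cvgA : (\int[P]_(w in A n) (H w)%:E)%E @[n --> \oo] --> (\int[P]_w (H w)%:E)%E.
    rewrite -[X in (\int[P]_(w in X) _)%E]AT.
    apply: ge0_nondecreasing_set_cvg_integral => //.
    - by move=> n m nm; apply/subsetPset => w; exact: alive_level.
    - by move=> n; apply/measurable_funTS/measurable_EFinP.
    - by move=> n w _; rewrite lee_fin.
  rewrite -(cvg_lim _ cvgA) //; apply: lime_le.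
    by apply/cvg_ex; eexists; exact: cvgA.
  exact: nearW.
have IH : L1 H.
  apply/integrableP; split; first exact/measurable_EFinP.
  rewrite (le_lt_trans _ (ltry kappa)) //; apply: le_trans leH.
  apply: ge0_le_integral => //.
  - by apply: measurableT_comp => //; exact/measurable_EFinP.
  - exact/measurable_EFinP.
  - by move=> w _ /=; rewrite ger0_norm.
have GH : {ae P, forall w, G w = H w} by apply: filterS G0 => w Gw; rewrite /H max_l.
split; first by apply: (L1_le mG IH); apply: filterS2 G0 GH => w Gw <-; rewrite ger0_norm.
rewrite (eq_E_ae mG mH GH) -lee_fin fineK //; exact: integrable_fin_num IH.
Qed.

End Stopping.

(** Since theta is below the superhedging portfolio up to solvent positions, its
    value is below the gain of the shifted portfolio minus the value of the
    shift. *)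
Lemma weak_duality (q p : process T Omega R) (theta : process T Omega (R * R))
    (x1 c : R) (X : Omega -> R) :
  consistent_prices q p -> E (fun w => \sum_(t < T.+1) q t w) = 1 ->
  L0 F theta -> (forall t, {ae P, forall w, c <= (theta t w).1 /\ c <= (theta t w).2}) ->
  Gamma P F K theta (x1, 0) ->
  X = (fun w => \sum_(t < T.+1) (q t w * (theta t w).1 + p t w * (theta t w).2)) ->
  L1 X /\ E X <= x1.
Proof.
move=> qp Eq mtheta theta_ge [_ [V [xi [mxi xiK] <-] VK]] -> {X}.
(* Shifted by (C, C), the portfolio is solvent at every date. *)
pose C := `|c|; pose x : R * R := (x1 + C, C).
have posE (t : 'I_T.+1) w : position xi x t.+1 w = wealth (x1, 0) xi t w + (C, C).
  rewrite /position /wealth addrAC; congr (_ + _).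
  by apply/pair_equal_spec; rewrite add0r.
have posK (t : 'I_T.+1) : {ae P, forall w, K t w (position xi x t.+1 w)}.
  move: (S_gt0 t) (VK t) (theta_ge t); apply: filterS3 => w S0 Vw [th1 th2].
  have -> : position xi x t.+1 w = (wealth (x1, 0) xi t w - theta t w) + (theta t w + (C, C)).
    by rewrite posE addrA subrK.
  apply: solvencyD => //; have cC : - C <= c by rewrite lerNl /C -normrN ler_norm.
  by apply: solvency_ge0 => //=; lra.
have [Iq Ip qpK _] := qp.
set G := fun w => \sum_(t < T.+1)
     (q t w * (position xi x t.+1 w).1 + p t w * (position xi x t.+1 w).2).
have [IG EG] := position_gain qp mxi xiK posK (erefl G).
pose s w := \sum_(t < T.+1) q t w; pose r w := \sum_(t < T.+1) p t w.
have Is : L1 s by exact: L1_sum.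
have Ir : L1 r by exact: L1_sum.
have mtheta' (t : 'I_T.+1) : measurable_fun setT (fun w => (theta t w).1) /\
    measurable_fun setT (fun w => (theta t w).2).
  by have /Fmeas_measurable/measurable_fun_pairP := mtheta t.
set X := fun w => _.
have mX : measurable_fun setT X.
  apply: measurable_sum => t; have [m1 m2] := mtheta' t.
  by apply: measurable_funD; apply: measurable_funM => //; exact: L1_measurable.
have lbX : {ae P, forall w, - (C * (s w + r w)) <= X w}.
  apply: filterS3 (ae_all qpK) (ae_all theta_ge) (ae_all S_gt0) => w qpw thw S0.
  have -> : - (C * (s w + r w)) = \sum_(t < T.+1) - (C * (q t w + p t w)).
    by rewrite sumrN /s /r -big_split big_distrr.
  apply: ler_sum => t _.
  have /= := qpw t (theta t w + (C, C)); have [th1 th2] := thw t.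
  have cC : - C <= c by rewrite lerNl /C -normrN ler_norm.
  have : K t w (theta t w + (C, C)) by apply: solvency_ge0 => //=; lra.
  by move=> thK /(_ thK); lra.
have ubX : {ae P, forall w, X w <= G w - C * (s w + r w)}.
  apply: filterS2 (ae_all qpK) (ae_all VK) => w qpw Vw.
  have -> : G w - C * (s w + r w) = \sum_(t < T.+1)
      (q t w * (wealth (x1, 0) xi t w).1 + p t w * (wealth (x1, 0) xi t w).2).
    rewrite /s /r -big_split big_distrr -sumrB; apply: eq_bigr => t _.
    by rewrite posE /=; ring.
  by apply: ler_sum => t _; have /= := qpw t _ (Vw t); lra.
have IC : L1 (fun w => C * (s w + r w)) by exact/L1Z/L1D.
have IX : L1 X.
  apply: (@L1_le _ _ _ _ _ (fun w => `|G w| + `|C * (s w + r w)|)) => //.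
    by apply: L1D; exact: L1_norm.
  apply: filterS2 lbX ubX => w lb ub; rewrite ler_norml; apply/andP; split.
    have := normr_ge0 (G w); have := ler_norm (C * (s w + r w)); lra.
  have := ler_norm (G w); have := ler_norm (- (C * (s w + r w))); rewrite normrN; lra.
split => //; apply: le_trans (le_E IX (L1B IG IC) ubX) _.
rewrite RintegralB // RintegralZl ?RintegralD //; last exact: L1D.
by move: EG; rewrite -/s -/r /= Eq; lra.
Qed.

End Market.

(** * Consistent prices and the set Q *)

Section Bridge.
Context {d : measure_display} {Omega : measurableType d} {R : realType}.
Variables (P : probability Omega R) (T : nat) (F : 'I_T.+1 -> set (set Omega)).
Hypothesis filtF : filtration P F.
Variables (mu lambda : R) (S : process T Omega R).
Hypotheses (mu01 : 0 < mu < 1) (lambda01 : 0 < lambda < 1).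
Hypothesis S_gt0 : forall t, {ae P, forall w, 0 < S t w}.
Hypothesis S_adapted : L0 F S.
Local Notation K := (solvency mu lambda S).
Local Notation L1 := (integrable_rv P).
Local Notation E f := (\int[P]_w f w).
Local Notation Fmeas t X := (measurable_fun setT (X : g_sigma_algebraType (F t) -> _)).

Lemma ae_and (A B : Omega -> Prop) : {ae P, forall w, A w} -> {ae P, forall w, B w} ->
  {ae P, forall w, A w /\ B w}.
Proof. by apply: filterS2 => w; split. Qed.

(** The two bounds place (a, b) in the dual cone, and force a >= 0. *)
Lemma solvency_dual t w (x : R * R) (a b : R) : 0 < S t w -> K t w x ->
  S t w * (1 - mu) * a <= b -> b <= S t w * (1 + lambda) * a -> 0 <= a * x.1 + b * x.2.
Proof.
move=> S0 /(solvencyP mu01 lambda01 _ S0)[x_mu x_lambda] ab ba.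
have [mu0 _] := andP mu01; have [la0 _] := andP lambda01.
have a0 : 0 <= a.
  have : 0 <= S t w * (mu + lambda) * a by lra.
  by rewrite pmulr_rge0 // mulr_gt0 // addr_gt0.
have [x2|x2] := leP 0 x.2.
  have := mulr_ge0 a0 x_mu.
  have : 0 <= (b - S t w * (1 - mu) * a) * x.2 by apply: mulr_ge0; lra.
  lra.
have := mulr_ge0 a0 x_lambda.
have : 0 <= (S t w * (1 + lambda) * a - b) * - x.2 by apply: mulr_ge0; lra.
lra.
Qed.

(** Since F_0 is trivial, one of the increasing events X <= n has probability
    1. *)
Lemma Fmeas0_bounded (X : Omega -> R) : Fmeas ord0 X -> exists n : nat, {ae P, forall w, X w <= n%:R}.
Proof.
move=> mX; pose B n := [set w | X w <= n%:R].
have FB n : F ord0 (B n).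
  apply: (measurable_Gset (F_sigma filtF _)); apply: measurable_bool_set.
  exact: measurable_fun_ler.
have mB n : measurable (B n) by exact: (F_measurable filtF (FB n)).
have [[n PB]|noB] := pselect (exists n, P (B n) = 1%E).
  exists n; exists (~` B n); split => //; first exact: measurableC.
  by rewrite probability_setC // PB subee.
have B0 n : {ae P, forall w, ~ B n w}.
  exists (B n); split => //; last by move=> w /contrapT.
  by case: filtF => _ _ _ /(_ _ (FB n)) [//|PB]; case: noB; exists n.
have ppf : ProperFilter (almost_everywhere P).
  apply: ae_properfilter_algebraOfSetsType.
  by rewrite -[X in (_ < X)%E]/(P setT) probability_setT.
have [w nBw] := filter_ex (ae_foralln B0).
case: (nBw (Num.truncn (X w)).+1); rewrite /B /= ltW //.
have [X0|X0] := leP 0 (X w); first exact: truncnS_gt.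
exact: lt_le_trans X0 (ler0n _ _).
Qed.

(** The pull-out property replaces the future sums with their conditional expectations,
    for which the inequalities of Q hold pointwise. *)
Lemma Q_consistent (chi q p : process T Omega R) : Q P F mu lambda S (chi, q) ->
  p = (fun t w => q t w * (chi t w * S t w)) ->
  consistent_prices P F mu lambda S q p /\ E (fun w => \sum_(t < T.+1) q t w) = 1.
Proof.
move=> [[mchi _ _] [mq q0 Iq] Eq1 chi_b cond] pE.
have [mu0 mu1] := andP mu01; have [la0 _] := andP lambda01.
have Fm (t : 'I_T.+1) : F t `<=` measurable by move=> A; exact: (F_measurable filtF).
have mp (t : 'I_T.+1) : measurable_fun setT (p t).
  have m (Y : Omega -> R) : Fmeas t Y -> measurable_fun setT Y.
    exact: (Fmeas_measurable filtF).
  rewrite pE; apply: measurable_funM; first exact: m (mq t).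
  by apply: measurable_funM; [exact: m (mchi t)|exact: m (@S_adapted t)].

have qp (t : 'I_T.+1) : {ae P, forall w, [/\ 0 < S t w,
    S t w * (1 - mu) * q t w <= p t w & p t w <= S t w * (1 + lambda) * q t w]}.
  move: (S_gt0 t) (q0 t) (chi_b t); apply: filterS3 => w S0 qw /andP[chi1 chi2].
  have qS : 0 <= q t w * S t w by rewrite mulr_ge0 // ltW.
  rewrite pE; split => //.
    have := mulr_ge0 qS (_ : 0 <= chi t w - (1 - mu)); lra.
  have := mulr_ge0 qS (_ : 0 <= 1 + lambda - chi t w); lra.
have p0 (t : 'I_T.+1) : {ae P, forall w, 0 <= p t w}.
  move: (qp t) (q0 t); apply: filterS2 => w [S0 pw _] qw; apply: le_trans pw.
  by apply: mulr_ge0 => //; apply: mulr_ge0; lra.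
have Ir t : L1 (remaining q t) by exact: L1_remaining.
have rem1 t m : is_Eq P F q t (fun _ _ => 1) m -> is_condE P (F t) (EFin \o remaining q t) m.
  rewrite /is_Eq; congr (is_condE _ _ _ _); apply/funext => w; congr _%:E.
  by apply: eq_bigr => s _; rewrite mulr1.
have remS t m : is_Eq P F q t (fun s w => chi s w * S s w) m ->
    is_condE P (F t) (EFin \o remaining p t) m.
  by rewrite /is_Eq; congr (is_condE _ _ _ _); apply/funext => w; rewrite pE.
have Ip t : L1 (p t).
  (* At date 0 the price S is essentially bounded, so that the upper inequality
     bounds the integral of the remaining p by that of the remaining q. *)
  have [m1 [mS [/rem1 cm1 /remS cmS ineq]]] := cond ord0.
  have [m1' [_ Im1 _] m1E] :=
    is_condE_condexp (F_sigma filtF ord0) (Fm ord0) (Ir ord0) cm1.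
  have [n Sn] := Fmeas0_bounded (@S_adapted ord0).
  pose g w := n%:R * (1 + lambda) * `|m1' w|.
  have Ig : L1 g by exact/L1Z/L1_norm.
  have g0 w : 0 <= g w by rewrite !mulr_ge0 // addr_ge0 // ltW.
  have mSg : {ae P, forall w, (mS w <= (g w)%:E)%E}.
    move: (ae_and Sn m1E) ineq (S_gt0 ord0); apply: filterS3 => w [Snw ->] [_ +] S0.
    move=> /le_trans; apply; rewrite -EFinM lee_fin /g.
    rewrite (le_trans (ler_norm _)) // normrM ler_wpM2r // normrM.
    by rewrite gtr0_norm // ger0_norm ?ler_wpM2r // addr_ge0 // ltW.
  have [_ mmS intS] := cmS.
  have mmS' : measurable_fun setT mS := Fmeas_measurable filtF mmS.
  have rem_ge0 : {ae P, forall w, 0 <= remaining p ord0 w}.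
    by apply: filterS (ae_all p0) => w pw; apply: sumr_ge0.
  have mrem : measurable_fun setT (remaining p ord0).
    rewrite (_ : remaining p ord0 = fun w => \sum_(s < T.+1) p s w); first exact: measurable_sum.
    by apply/funext => w; apply: eq_bigl.
  have Irem : L1 (remaining p ord0).
    apply/integrableP; split; first exact/measurable_EFinP.
    apply: (@le_lt_trans _ _ (\int[P]_w (g w)%:E)%E); last first.
      by rewrite -[ltLHS]fineK ?ltry //; exact: integrable_fin_num Ig.
    rewrite (@ae_eq_integral _ _ _ P setT (EFin \o remaining p ord0)) //; last first.
      by apply: filterS rem_ge0 => w rw _ /=; rewrite ger0_norm.
      exact/measurable_EFinP.
      by apply: measurableT_comp => //; exact/measurable_EFinP.
    have FT : F ord0 setT.
      by apply: (measurable_Gset (F_sigma filtF _)); exact: measurableT.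
    rewrite -intS // integralE (@le_trans _ _ (\int[P]_w (mS^\+ w))%E) //.
      by rewrite geeDl // oppe_le0 integral_ge0.
    apply: ae_ge0_le_integral => //.
    - exact: measurable_funepos.
    - by move=> w _; rewrite lee_fin.
    - by apply/measurable_EFinP; exact: L1_measurable Ig.
    - by apply: filterS mSg => w mg _; rewrite unlock ge_max mg lee_fin g0.
  apply: L1_le (mp t) Irem _; apply: filterS (ae_all p0) => w pw.
  rewrite ger0_norm // /remaining (bigD1 t) //= lerDl; exact: sumr_ge0.
split; last by move: Eq1; rewrite unlock => Eq1; rewrite /Rintegral Eq1.
split => //.
  move=> t; apply: filterS (qp t) => w [S0 pq qp'] x Kx.
  exact: solvency_dual Kx pq qp'.
move=> t eta M /Fmeas_pair[m1e m2e] Me Keta.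
have [m1 [mS [/rem1 cm1 /remS cmS ineq]]] := cond t.
have Irp : L1 (remaining p t) by exact: L1_remaining.
have {Fm} Fm := Fm t; have sF := F_sigma filtF t.
have [a [ma Ia ca] aE] := is_condE_condexp sF Fm (Ir t) cm1.
have [b [mb Ib cb] bE] := is_condE_condexp sF Fm Irp cmS.
have e1 w := proj1 (Me w); have e2 w := proj2 (Me w).
have m1e' := Fmeas_measurable filtF m1e; have m2e' := Fmeas_measurable filtF m2e.
rewrite RintegralD //; last 2 first.
- exact: L1M m1e' e1 (Ir t).
- exact: L1M m2e' e2 Irp.
rewrite (condexp_pull_out sF Fm (Ir t) (And3 ma Ia ca) m1e e1).
rewrite (condexp_pull_out sF Fm Irp (And3 mb Ib cb) m2e e2).
have I1 := L1M m1e' e1 Ia; have I2 := L1M m2e' e2 Ib.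
rewrite -RintegralD // -[leLHS](_ : E (fun=> 0) = 0); last first.
  by rewrite Rintegral_cst // mul0r.
apply: le_E; [exact: L1_cst|exact: L1D|].
move: (ae_and aE bE) (ae_and ineq Keta) (S_gt0 t).
apply: filterS3 => w [-> ->] [+ Kw] S0; rewrite -!EFinM !lee_fin => -[ab ba].
by rewrite [X in X + _]mulrC [X in _ + X]mulrC; exact: solvency_dual Kw ab ba.
Qed.

End Bridge.

Section Converse.
Context {d : measure_display} {Omega : measurableType d} {R : realType}.
Variables (P : probability Omega R) (T : nat) (F : 'I_T.+1 -> set (set Omega)).
Hypothesis filtF : filtration P F.
Variables (mu lambda : R) (S : process T Omega R).
Hypotheses (mu01 : 0 < mu < 1) (lambda01 : 0 < lambda < 1).
Hypothesis S_gt0 : forall t, {ae P, forall w, 0 < S t w}.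
Hypothesis S_adapted : L0 F S.
Local Notation L1 := (integrable_rv P).
Local Notation E f := (\int[P]_w f w).

Local Notation Fmeas t X := (measurable_fun setT (X : g_sigma_algebraType (F t) -> _)).

(** Conversely, a dual pair satisfies the inequalities of Q: it is tested against
    the two extreme rays of K_t, restricted to events of F_t on which they are
    bounded. *)
Lemma dual_pair_bounds t (a b ma mb : Omega -> R) : L1 a -> L1 b ->
  is_condexp P (F t) a ma -> is_condexp P (F t) b mb ->
  dual_pair P F mu lambda S t a b ->
  {ae P, forall w, S t w * (1 - mu) * ma w <= mb w /\
                   mb w <= S t w * (1 + lambda) * ma w}.
Proof.
move=> Ia Ib cma cmb dual.
have [mu0 mu1] := andP mu01; have [la0 _] := andP lambda01.
have Fm : F t `<=` measurable by move=> A; exact: (F_measurable filtF).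
have sF := F_sigma filtF t.
have mSt c : Fmeas t (fun w => S t w * c).
  by apply: measurable_funM => //; exact: S_adapted.
have mc (c : R) : Fmeas t (fun=> c : R) by exact: measurable_cst.
have test (A : set Omega) (M : R) (x y : Omega -> R) : F t A -> Fmeas t x -> Fmeas t y ->
    (forall w, A w -> `|x w| <= M /\ `|y w| <= M) ->
    (forall w, 0 < S t w -> solvency mu lambda S t w (x w, y w)) ->
    0 <= E (fun w => \1_A w * (x w * a w)) + E (fun w => \1_A w * (y w * b w)).
  move=> FA mx my xyM xyK; have mA := Fm _ FA; have mGA := Gset_measurable FA.
  have mi : Fmeas t (\1_A : Omega -> R) by exact: measurable_indic.
  have mx1 : Fmeas t (fun w => \1_A w * x w) by exact: measurable_funM.
  have my1 : Fmeas t (fun w => \1_A w * y w) by exact: measurable_funM.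
  have bnd w : `|\1_A w * x w| <= `|M| /\ `|\1_A w * y w| <= `|M|.
    rewrite indicE; case: (boolP (w \in A)) => [|_]; last by rewrite !mul0r normr0.
    by rewrite inE !mul1r => /xyM[xM yM]; have := ler_norm M; split; lra.
  rewrite -RintegralD //.
  - under eq_Rintegral do rewrite !mulrA.
    apply: (dual (fun w => (\1_A w * x w, \1_A w * y w)) `|M|) => //.
      by apply/Fmeas_pair.
    apply: filterS (S_gt0 t) => w S0; rewrite indicE.
    case: (w \in A); first by rewrite !mul1r; exact: xyK.
    by rewrite !mul0r; exact: solvency0.
  - under [X in _ _ X]eq_fun do rewrite mulrA.
    by apply: L1M Ia => [|w]; [exact: (Fmeas_measurable filtF mx1)|exact: (bnd w).1].
  - under [X in _ _ X]eq_fun do rewrite mulrA.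
    by apply: L1M Ib => [|w]; [exact: (Fmeas_measurable filtF my1)|exact: (bnd w).2].
have IA (A : set Omega) (M : R) (x c : Omega -> R) : F t A -> L1 c -> Fmeas t x ->
    (forall w, A w -> `|x w| <= M) -> L1 (fun w => \1_A w * (x w * c w)).
  move=> FA Ic mx xM; under [X in _ _ X]eq_fun do rewrite mulrA.
  have mxA : Fmeas t (fun w => \1_A w * x w).
    by apply: measurable_funM => //; apply: measurable_indic; exact: Gset_measurable.
  apply: (@L1M _ _ _ _ `|M|) => // [|w]; first exact: (Fmeas_measurable filtF mxA).
  rewrite indicE; case: (boolP (w \in A)) => [|_]; last by rewrite mul0r normr0.
  by rewrite inE mul1r => /xM xw; apply: le_trans xw (ler_norm _).
have opp (A : set Omega) (M : R) (x c : Omega -> R) : F t A -> L1 c -> Fmeas t x ->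
    (forall w, A w -> `|x w| <= M) ->
    E (fun w => \1_A w * (- x w * c w)) = - E (fun w => \1_A w * (x w * c w)).
  move=> FA Ic mx xM; rewrite -mulN1r -RintegralZl //; last exact: (IA A M).
  by apply: eq_Rintegral => w _; ring.
(* The test positions (- S (1 - mu), 1) and (S (1 + lambda), -1) are the extreme
   rays of the solvency cone. *)
have lower : {ae P, forall w, S t w * (1 - mu) * ma w <= 1 * mb w}.
  apply: (condexp_le sF Fm Ia Ib cma cmb) => // A M FA AM.
  have := test A M (fun w => - (S t w * (1 - mu))) (fun=> 1) FA.
  rewrite (opp A M) //; last by move=> w /AM[].
  move=> tst; rewrite -subr_ge0 addrC; apply: tst => //.
  - exact: measurable_funN.
  - by move=> w /AM; rewrite normrN.
  - by move=> w S0; apply/(solvencyP mu01 lambda01 _ S0); split => /=; nra.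
have upper : {ae P, forall w, 1 * mb w <= S t w * (1 + lambda) * ma w}.
  apply: (condexp_le sF Fm Ib Ia cmb cma) => // A M FA AM.
  have := test A M (fun w => S t w * (1 + lambda)) (fun=> - 1) FA.
  rewrite (opp A M) //; last by move=> w /AM[].
  move=> tst; rewrite -subr_ge0; apply: tst => //.
  - by move=> w /AM[? ?]; rewrite normrN.
  - by move=> w S0; apply/(solvencyP mu01 lambda01 _ S0); split => /=; nra.
by apply: filterS2 lower upper => w; rewrite mul1r.
Qed.

(** The ratio p / (q S) defines chi wherever q is positive, and p vanishes with
    q. *)
Lemma Q_of_prices (q p : process T Omega R) :
  L0 F q -> L0 F p -> (forall t, L1 (q t)) -> (forall t, L1 (p t)) ->
  (forall t, {ae P, forall w, S t w * (1 - mu) * q t w <= p t w /\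
                              p t w <= S t w * (1 + lambda) * q t w}) ->
  E (fun w => \sum_(t < T.+1) q t w) = 1 ->
  (forall t, dual_pair P F mu lambda S t (remaining q t) (remaining p t)) ->
  exists2 chi, Q P F mu lambda S (chi, q) &
    forall t, {ae P, forall w, q t w * (chi t w * S t w) = p t w}.
Proof.
move=> mq mp Iq Ip pq Eq weak.
have [mu0 mu1] := andP mu01; have [la0 _] := andP lambda01.
have Fm (t : 'I_T.+1) : F t `<=` measurable by move=> A; exact: (F_measurable filtF).
have sF := F_sigma filtF.
have mFE (t : 'I_T.+1) (Y : Omega -> R) :
    measurable_fun setT (Y : g_sigma_algebraType (F t) -> R) -> measurable_fun setT Y.
  exact: (Fmeas_measurable filtF).
(* The value where q vanishes is free within the bounds; 1 is always admissible.
   The power -1 of the absolute value is a measurable form of the inverse. *)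
pose chi : process T Omega R := fun t w =>
  if q t w == 0 then 1 else p t w * `|q t w * S t w| `^ (-1).
have q0 t : {ae P, forall w, 0 <= q t w}.
  apply: filterS2 (S_gt0 t) (pq t) => w S0 [p1 p2].
  have : 0 <= S t w * (mu + lambda) * q t w by lra.
  by rewrite pmulr_rge0 // mulr_gt0 // addr_gt0.
have mchi : L0 F chi.
  move=> t; rewrite /chi; apply: measurable_fun_ifT.
  - by apply: measurable_fun_eqr => //; exact: mq.
  - exact: measurable_cst.
  apply: measurable_funM; first exact: mp.
  apply: (measurableT_comp (measurable_powR (-1))); apply: measurableT_comp => //.
  by apply: measurable_funM; [exact: mq|exact: S_adapted].
have chiE t : {ae P, forall w, q t w * (chi t w * S t w) = p t w /\ 1 - mu <= chi t w <= 1 + lambda}.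
  apply: filterS3 (S_gt0 t) (q0 t) (pq t) => w S0 qw [p1 p2].
  rewrite /chi; case: eqP => [q_eq0|/eqP q_neq0].
    split; last by apply/andP; split; lra.
    by move: p1 p2; rewrite q_eq0; lra.
  have qS : 0 < q t w * S t w by rewrite mulr_gt0 // lt_neqAle eq_sym q_neq0.
  rewrite powR_inv1 // gtr0_norm //; split.
    by field; rewrite q_neq0 gt_eqF.
  rewrite ler_pdivlMr // ler_pdivrMr //; apply/andP; split; lra.
exists chi; last by move=> t; apply: filterS (chiE t) => w [].
have chi_ge0 t : {ae P, forall w, 0 <= chi t w}.
  by apply: filterS (chiE t) => w [_ /andP[+ _]]; lra.
(* A version of p that has the product form of Q everywhere. *)
pose p' : process T Omega R := fun t w => q t w * (chi t w * S t w).
have mp' t : measurable_fun setT (p' t).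
  apply: measurable_funM; first exact: mFE (mq t).
  by apply: measurable_funM; [exact: mFE (mchi t)|exact: mFE (@S_adapted t)].
have Ip' t : L1 (p' t).
  apply: L1_le (mp' t) (L1_norm (Ip t)) _.
  by apply: filterS (chiE t) => w [pE _]; rewrite /p' pE.
have Ir t : L1 (remaining q t) by exact: L1_remaining.
have Irp t : L1 (remaining p t) by exact: L1_remaining.
have Irp' t : L1 (remaining p' t) by exact: L1_remaining.
have rem_p t : {ae P, forall w, remaining p' t w = remaining p t w}.
  by apply: filterS (ae_all chiE) => w pE; apply: eq_bigr => s _; case: (pE s).
have dual' t : dual_pair P F mu lambda S t (remaining q t) (remaining p' t).
  move=> eta M meta bM Keta.
  have /(Fmeas_measurable filtF)/measurable_fun_pairP[m1 m2] := meta.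
  have Mr t' := L1_measurable (Ir t'); have Mp t' := L1_measurable (Irp t').
  have Mp' t' := L1_measurable (Irp' t').
  rewrite (@eq_E_ae _ _ _ P _ (fun w => (eta w).1 * remaining q t w + (eta w).2 * remaining p t w)).
  - exact: weak meta bM Keta.
  - by apply: measurable_funD; apply: measurable_funM.
  - by apply: measurable_funD; apply: measurable_funM.
  - by apply: filterS (rem_p t) => w ->.
split => //.
- split => // t; apply: (@L1_le _ _ _ _ _ (fun=> 1 + lambda)); first exact: mFE.
    exact: L1_cst.
  by apply: filterS2 (chiE t) (chi_ge0 t) => w [_ /andP[_ +]] ?; rewrite ger0_norm.
- by rewrite unlock -Eq fineK //; apply: integrable_fin_num => //; exact: L1_sum.
- by move=> t; apply: filterS (chiE t) => w [].
move=> t.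
have [m1 cm1] := condexp_exists (sF t) (Fm t) (Ir t).
have [mS cmS] := condexp_exists (sF t) (Fm t) (Irp' t).
exists (EFin \o m1), (EFin \o mS).
split.
- move: (condexp_is_condE (Ir t) cm1); rewrite /is_Eq; congr (is_condE _ _ _ _).
  by apply/funext => w; congr _%:E; apply: eq_bigr => s _; rewrite mulr1.
- exact: condexp_is_condE (Irp' t) cmS.
apply: filterS (dual_pair_bounds (Ir t) (Irp' t) cm1 cmS (dual' t)) => w.
by rewrite /= -!EFinM !lee_fin.
Qed.

End Converse.

(** * The cone of superhedgeable processes *)

Section StrongDuality.
Context {d : measure_display} {Omega : measurableType d} {R : realType}.
Variables (P : probability Omega R) (T : nat) (F : 'I_T.+1 -> set (set Omega)).
Hypothesis filtF : filtration P F.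
Variables (mu lambda : R) (S : process T Omega R).
Hypotheses (mu01 : 0 < mu < 1) (lambda01 : 0 < lambda < 1).
Hypothesis S_gt0 : forall t, {ae P, forall w, 0 < S t w}.
Local Notation K := (solvency mu lambda S).
Local Notation Fmeas t X := (measurable_fun setT (X : g_sigma_algebraType (F t) -> _)).
Local Notation V := ('I_T.+1 -> Omega -> R * R).
Local Notation A := (superhedgeable P F K 0).

Lemma L0_pair (v : V) : L0 F v <->
  (forall t, Fmeas t (fun w => (v t w).1) /\ Fmeas t (fun w => (v t w).2)).
Proof. by split=> mv t; apply/Fmeas_pair; exact: mv. Qed.

Lemma L0_lin (u v : V) c : L0 F u -> L0 F v -> L0 F (u + c *: v).
Proof.
move=> /L0_pair mu' /L0_pair mv; apply/L0_pair => t.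
have [u1 u2] := mu' t; have [v1 v2] := mv t.
by split; apply: measurable_funD => //; apply: measurable_funM.
Qed.

Lemma superhedgeable_lin (u v : V) c : 0 <= c -> A u -> A v -> A (u + c *: v).
Proof.
move=> c0 [mu' [_ [xi [mxi xiK] <-] uK]] [mv [_ [zeta [mzeta zetaK] <-] vK]].
split; first exact: L0_lin.
exists (wealth 0 (xi + c *: zeta)).
  exists (xi + c *: zeta) => //; split; first exact: L0_lin.
  move=> t; apply: filterS3 (S_gt0 t) (xiK t) (zetaK t) => w S0 xiw zw.
  have -> : - (xi + c *: zeta) t w = - xi t w + c *: (- zeta t w).
    by rewrite scalerN -opprD.
  by apply: solvencyD => //; apply: solvencyZ.
move=> t; apply: filterS3 (S_gt0 t) (uK t) (vK t) => w S0 uw vw.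
have -> : wealth 0 (xi + c *: zeta) t w - (u + c *: v) t w =
    (wealth 0 xi t w - u t w) + c *: (wealth 0 zeta t w - v t w).
  rewrite scalerBr addrACA -opprD; congr (_ - _).
  by rewrite /wealth !add0r scaler_sumr -big_split.
by apply: solvencyD => //; apply: solvencyZ.
Qed.

Lemma L0_0 : L0 F (0 : V).
Proof. by move=> t; exact: measurable_cst. Qed.

(** A process with values in - K is superhedged by doing nothing. *)
Lemma superhedgeable_null (v : V) : L0 F v ->
  (forall t, {ae P, forall w, K t w (- v t w)}) -> A v.
Proof.
move=> mv vK; split => //; exists (wealth 0 (0 : V)).
  exists (0 : V) => //; split; first exact: L0_0.
  by move=> t; apply: aeW => w; rewrite oppr0; exact: solvency0.
move=> t; apply: filterS (vK t) => w.
by rewrite /wealth big1 // addr0 sub0r.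
Qed.

Lemma superhedgeable_wealth (xi : V) : strategies P F K xi -> L0 F (wealth 0 xi) ->
  A (wealth 0 xi).
Proof.
move=> xiS mw; split => //; exists (wealth 0 xi); first by exists xi.
by move=> t; apply: aeW => w; rewrite subrr; exact: solvency0.
Qed.

Lemma superhedgeable_shift (theta : V) (x : R * R) : L0 F theta ->
  A (fun t w => theta t w - x) -> Gamma P F K theta x.
Proof.
move=> mtheta [_ [_ [xi [mxi xiK] <-] VK]]; split => //.
exists (wealth x xi); first by exists xi.
move=> t; apply: filterS (VK t) => w.
by rewrite /wealth opprB add0r addrA [x + _]addrC.
Qed.

Lemma cvg_norm_pair (x_ : nat -> R * R) (l : R * R) :
  (x_ n).1 @[n --> \oo] --> l.1 -> (x_ n).2 @[n --> \oo] --> l.2 ->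
  `|x_ n - l| @[n --> \oo] --> 0.
Proof.
move=> /cvgrPdist_lt x1 /cvgrPdist_lt x2; apply/cvgrPdist_lt => e e0.
apply: filterS2 (x1 e e0) (x2 e e0) => n xn1 xn2.
rewrite sub0r normrN normr_id prod_normE gt_max /=.
by rewrite distrC xn1 distrC xn2.
Qed.

Lemma cvg_sumr (I : Type) (s : seq I) (f : I -> nat -> R) (l : I -> R) :
  (forall i, f i n @[n --> \oo] --> l i) ->
  \sum_(i <- s) f i n @[n --> \oo] --> \sum_(i <- s) l i.
Proof.
move=> fl; elim: s => [|i s IH].
  by rewrite big_nil; under eq_fun do rewrite big_nil; exact: cvg_cst.
rewrite big_cons; under eq_fun do rewrite big_cons.
by have := cvgD (fl i) IH; apply.
Qed.

Hypothesis A_closed : closed_in_measure P F A.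

(** Closedness in measure, for almost sure limits. *)
Lemma superhedgeable_ae_cvg (u_ : nat -> V) (v : V) : (forall n, A (u_ n)) -> L0 F v ->
  (forall t, {ae P, forall w, (u_ n t w).1 @[n --> \oo] --> (v t w).1 /\
                              (u_ n t w).2 @[n --> \oo] --> (v t w).2}) -> A v.
Proof.
move=> Au mv uv; apply: (A_closed Au mv) => e e0.
apply: ae_cvg_in_measure => //.
  move=> n; apply: measurable_sum => t.
  have mun : L0 F (u_ n) by case: (Au n).
  have /L0_pair/(_ t)[m1 m2] : L0 F (u_ n - v) by rewrite -scaleN1r; exact: L0_lin.
  under eq_fun do rewrite prod_normE.
  apply: (Fmeas_measurable filtF (t := t)).
  by apply: measurable_maxr; apply: measurableT_comp.
apply: filterS (ae_all uv) => w uvw.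
have := @cvg_sumr _ (index_enum 'I_T.+1) (fun t n => `|u_ n t w - v t w|) (fun=> 0).
by rewrite big1 //; apply => t; have [u1 u2] := uvw t; exact: cvg_norm_pair.
Qed.

End StrongDuality.

(** * Separation in a weighted space *)

Section Separation.
Context {d : measure_display} {Omega : measurableType d} {R : realType}.
Variables (P : probability Omega R) (T : nat) (F : 'I_T.+1 -> set (set Omega)).
Hypothesis filtF : filtration P F.
Variables (mu lambda : R) (S : process T Omega R).
Hypotheses (mu01 : 0 < mu < 1) (lambda01 : 0 < lambda < 1).
Hypothesis S_gt0 : forall t, {ae P, forall w, 0 < S t w}.
Local Notation K := (solvency mu lambda S).
Local Notation L1 := (integrable_rv P).
Local Notation E f := (\int[P]_w f w).
Local Notation Fmeas t X := (measurable_fun setT (X : g_sigma_algebraType (F t) -> _)).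
Local Notation V := ('I_T.+1 -> Omega -> R * R).
Local Notation A := (superhedgeable P F K 0).
Hypothesis A_closed : closed_in_measure P F A.

Section WeightedL2.
Variable rho : process T Omega R.
Hypotheses (rho_gt0 : forall t w, 0 < rho t w) (rho_le1 : forall t w, rho t w <= 1).
Hypothesis rho_adapted : L0 F rho.

(** The weighted inner product before integration. *)
Definition dot (u v : V) (w : Omega) : R :=
  \sum_(t < T.+1) rho t w * ((u t w).1 * (v t w).1 + (u t w).2 * (v t w).2).

Definition L2 : set V := [set v | L0 F v /\ L1 (dot v v)].

Let rhoM t : measurable_fun setT (rho t).
Proof. exact: (Fmeas_measurable filtF (@rho_adapted t)). Qed.

Lemma L0_measurable (v : V) t : L0 F v ->
  measurable_fun setT (fun w => (v t w).1) /\ measurable_fun setT (fun w => (v t w).2).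
Proof. by move=> /(_ t)/(Fmeas_measurable filtF)/measurable_fun_pairP. Qed.

Lemma dot_measurable (u v : V) : L0 F u -> L0 F v -> measurable_fun setT (dot u v).
Proof.
move=> mu' mv; apply: measurable_sum => t; apply: measurable_funM => //.
have [u1 u2] := L0_measurable t mu'; have [v1 v2] := L0_measurable t mv.
by apply: measurable_funD; apply: measurable_funM.
Qed.

Lemma dot_ge0 (u : V) w : 0 <= dot u u w.
Proof.
apply: sumr_ge0 => t _; apply: mulr_ge0; first exact: ltW.
by rewrite addr_ge0 // -expr2 sqr_ge0.
Qed.

(** This replaces the Cauchy-Schwarz inequality in the proof of integrability. *)
Lemma dot_young (u v : V) w : `|dot u v w| <= dot u u w + dot v v w.
Proof.
apply: (le_trans (ler_norm_sum _ _ _)); rewrite -big_split; apply: ler_sum => t _ /=.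
rewrite -mulrDr normrM gtr0_norm // ler_pM2l // ler_norml.
set a := (u t w).1; set b := (u t w).2; set x := (v t w).1; set y := (v t w).2.
have := sqr_ge0 (a + x); have := sqr_ge0 (b + y).
have := sqr_ge0 (a - x); have := sqr_ge0 (b - y).
have := sqr_ge0 a; have := sqr_ge0 b; have := sqr_ge0 x; have := sqr_ge0 y.
by move=> *; apply/andP; split; lra.
Qed.

Lemma L1_dot (u v : V) : L2 u -> L2 v -> L1 (dot u v).
Proof.
move=> [mu' Iu] [mv Iv]; apply: (L1_le (dot_measurable mu' mv) (L1D Iu Iv)).
by apply: aeW => w; exact: dot_young.
Qed.

Lemma dot_expand (u v : V) c w :
  dot (u + c *: v) (u + c *: v) w = dot u u w + 2 * c * dot u v w + c ^+ 2 * dot v v w.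
Proof.
rewrite /dot !mulr_sumr -!big_split; apply: eq_bigr => t _.
by rewrite /= /GRing.scale /=; ring.
Qed.

Lemma L2_lin (u v : V) c : L2 u -> L2 v -> L2 (u + c *: v).
Proof.
move=> Hu Hv; have [mu' Iu] := Hu; have [mv Iv] := Hv; split; first exact: L0_lin.
rewrite (_ : dot _ _ = fun w => dot u u w + 2 * c * dot u v w + c ^+ 2 * dot v v w).
  by apply: L1D; [apply: L1D => //|]; apply: L1Z => //; exact: L1_dot.
by apply/funext => w; exact: dot_expand.
Qed.

Lemma E_dot_expand (u v : V) c : L2 u -> L2 v ->
  E (dot (u + c *: v) (u + c *: v)) =
  E (dot u u) + 2 * c * E (dot u v) + c ^+ 2 * E (dot v v).
Proof.
move=> Hu Hv; have Iu := proj2 Hu; have Iv := proj2 Hv; have Iuv := L1_dot Hu Hv.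
under eq_Rintegral do rewrite dot_expand.
by rewrite !RintegralD ?RintegralZl //; do ?[apply: L1D|apply: L1Z].
Qed.

Lemma L2_bounded (v : V) (M : R) : L0 F v ->
  (forall t w, `|(v t w).1| <= M /\ `|(v t w).2| <= M) -> L2 v.
Proof.
move=> mv vM; split => //.
apply: (@L1_le _ _ _ _ _ (fun=> \sum_(t < T.+1) (M ^+ 2 + M ^+ 2))).
- exact: dot_measurable.
- exact: L1_cst.
apply: aeW => w; rewrite ger0_norm ?dot_ge0 //; apply: ler_sum => t _.
have [v1 v2] := vM t w; rewrite -!expr2 -[leRHS]mul1r; apply: ler_pM => //.
- exact: ltW.
- by rewrite addr_ge0 ?sqr_ge0.
- by apply: lerD; rewrite -[leLHS]real_normK ?num_real // lerXn2r // nnegrE (le_trans _ v1) .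
Qed.

Lemma L2_component (v : V) t (a : Omega -> R) : L2 v ->
  measurable_fun setT a -> (forall w, a w ^+ 2 <= (v t w).1 ^+ 2 + (v t w).2 ^+ 2) ->
  L1 (fun w => rho t w * a w ^+ 2) /\
  E (fun w => rho t w * a w ^+ 2) <= E (dot v v).
Proof.
move=> [mv Iv] ma av.
have le_dot w : 0 <= rho t w * a w ^+ 2 <= dot v v w.
  apply/andP; split; first by rewrite mulr_ge0 ?sqr_ge0 // ltW.
  rewrite /dot (bigD1 t) //= -[leLHS]addr0; apply: lerD.
    by rewrite ler_pM2l // -!expr2.
  apply: sumr_ge0 => s _; apply: mulr_ge0; first exact: ltW.
  by rewrite -!expr2 addr_ge0 ?sqr_ge0.
have Ia : L1 (fun w => rho t w * a w ^+ 2).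
  apply: (L1_le _ Iv); first by apply: measurable_funM => //; exact: measurable_funX.
  by apply: aeW => w; have /andP[a0 ale] := le_dot w; rewrite ger0_norm.
by split => //; apply: le_E => //; apply: aeW => w; have /andP[] := le_dot w.
Qed.

(** Every component converges almost surely and the limit is adapted; Fatou's
    lemma bounds its distance to h. *)
Lemma L2_complete (u_ : nat -> V) (h : V) (e : R) : L2 h ->
  (forall n, (A `&` L2) (u_ n)) -> (forall n, E (dot (h - u_ n) (h - u_ n)) <= e) ->
  (forall n, E (dot (u_ n.+1 - u_ n) (u_ n.+1 - u_ n)) <= 4^-1 ^+ n) ->
  exists2 p, (A `&` L2) p & forall a n0,
    (forall n, (n0 <= n)%N -> E (dot (h - u_ n) (h - u_ n)) <= a) ->
    E (dot (h - p) (h - p)) <= a.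
Proof.
move=> Hh Au hu fast.
have mun n : L0 F (u_ n) by have [_ []] := Au n.
have L2B (u v : V) : L2 u -> L2 v -> L2 (u - v).
  by move=> Hu Hv; rewrite -scaleN1r; exact: L2_lin.
have H_step n : L2 (u_ n.+1 - u_ n) by apply: L2B; [have [] := Au n.+1|have [] := Au n].
have lim_comp (c : R * R -> R) : measurable_fun setT c ->
    (forall x y, c (x - y) = c x - c y) ->
    (forall x, c x ^+ 2 <= x.1 ^+ 2 + x.2 ^+ 2) ->
    forall t, exists g : Omega -> R, Fmeas t g /\
      {ae P, forall w, c (u_ n t w) @[n --> \oo] --> g w}.
  move=> mc cB c_le t.
  have mcu n : Fmeas t (fun w => c (u_ n t w)) by apply: measurableT_comp mc _; exact: mun.
  have step n : L1 (fun w => rho t w * (c (u_ n.+1 t w) - c (u_ n t w)) ^+ 2) /\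
      E (fun w => rho t w * (c (u_ n.+1 t w) - c (u_ n t w)) ^+ 2) <= 4^-1 ^+ n.
    have [||I1 E1] := L2_component (t := t)
      (a := fun w => c (u_ n.+1 t w) - c (u_ n t w)) (H_step n).
    - by apply: measurable_funB; exact: (Fmeas_measurable filtF (mcu _)).
    - by move=> w; rewrite -cB; exact: c_le.
    - by split => //; exact: le_trans E1 _.
  have [n||n|n|g mg gP] := @fast_cauchy_ae_cvg _ _ _ P (F t) (fun n w => c (u_ n t w)) (rho t).
  - exact: mcu.
  - exact: rho_gt0.
  - by case: (step n).
  - by case: (step n).
  - by exists g.
have /choice[g1 g1P] := lim_comp fst measurable_fst (fun _ _ => erefl)
  (fun x => ler_wpDr (sqr_ge0 x.2) (lexx (x.1 ^+ 2))).
have /choice[g2 g2P] := lim_comp snd measurable_snd (fun _ _ => erefl)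
  (fun x => ler_wpDl (sqr_ge0 x.1) (lexx (x.2 ^+ 2))).
pose p : V := fun t w => (g1 t w, g2 t w).
have mp : L0 F p by apply/L0_pair => t; split; [exact: (g1P t).1|exact: (g2P t).1].
have up t : {ae P, forall w, (u_ n t w).1 @[n --> \oo] --> (p t w).1 /\
                             (u_ n t w).2 @[n --> \oo] --> (p t w).2}.
  by apply: filterS2 (g1P t).2 (g2P t).2 => w; split.
have Ap : A p.
  by apply: (superhedgeable_ae_cvg filtF A_closed _ mp up) => n; case: (Au n).
have mhp : L0 F (h - p) by rewrite -scaleN1r; apply: L0_lin => //; case: Hh.
have dot_cvg : {ae P, forall w, dot (h - u_ n) (h - u_ n) w @[n --> \oo] --> dot (h - p) (h - p) w}.
  apply: filterS (ae_all up) => w upw; apply: cvg_sumr => t.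
  have [u1 u2] := upw t; apply: cvgMr.
  by apply: cvgD; apply: cvgM; apply: cvgB => //; exact: cvg_cst.
have lim a n0 : (forall n, (n0 <= n)%N -> E (dot (h - u_ n) (h - u_ n)) <= a) ->
    L1 (dot (h - p) (h - p)) /\ E (dot (h - p) (h - p)) <= a.
  move=> ua; apply: (@fatou_L1 _ _ _ _ (fun n => dot (h - u_ (n + n0)%N) (h - u_ (n + n0)%N))).
  - by move=> n; apply: (L2B _ _ Hh _).2; case: (Au (n + n0)%N).
  - by move=> n w; exact: dot_ge0.
  - by move=> n; apply: ua; exact: leq_addl.
  - exact: dot_measurable.
  - by move=> w; exact: dot_ge0.
  - apply: filterS dot_cvg => w; rewrite -(cvg_shiftn n0); exact.
exists p; last by move=> a n0 /lim[].
split => //; have Hhp : L2 (h - p) by split => //; case: (lim e 0%N (fun n _ => hu n)).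
by rewrite -[p](subKr h); exact: L2B.
Qed.

(** The two components of f weighted by rho: the candidate prices q and p before
    normalization. *)
Definition weighted1 (f : V) : process T Omega R := fun t w => rho t w * (f t w).1.
Definition weighted2 (f : V) : process T Omega R := fun t w => rho t w * (f t w).2.

Lemma L2_test (t : 'I_T.+1) (eta : Omega -> R * R) (M : R) (v : V)
    (J : pred 'I_T.+1) :
  Fmeas t eta -> (forall w, `|(eta w).1| <= M /\ `|(eta w).2| <= M) ->
  (forall s, J s -> (t <= s)%N) ->
  v = (fun s w => if J s then - eta w else 0) -> L2 v.
Proof.
move=> meta bM Jt vE.
have mv : L0 F v.
  move=> s; rewrite vE; case: (boolP (J s)) => [/Jt ts|_]; last exact: measurable_cst.
  have /Fmeas_pair[m1 m2] := Fmeas_le filtF ts meta.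
  by apply/Fmeas_pair; split; [exact: measurable_funN m1|exact: measurable_funN m2].
apply: (@L2_bounded _ `|M|) => // s w; have [b1 b2] := bM w.
have MM := ler_norm M; rewrite vE; case: ifP => _ /=; last by rewrite normr0 normr_ge0.
by rewrite !normrN; split; [exact: le_trans b1 _|exact: le_trans b2 _].
Qed.

(** A position - eta held on the set of dates J. *)
Lemma dot_test (f v : V) (eta : Omega -> R * R) (J : pred 'I_T.+1) w :
  v = (fun s w => if J s then - eta w else 0) ->
  dot f v w = - ((eta w).1 * (\sum_(s < T.+1 | J s) weighted1 f s w) +
                 (eta w).2 * (\sum_(s < T.+1 | J s) weighted2 f s w)).
Proof.
move=> ->; rewrite /dot (bigID J) /= addrC big1 => [|s Js]; last first.
  by rewrite (negbTE Js) /= !mulr0 addr0 mulr0.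
rewrite add0r !mulr_sumr -big_split -sumrN; apply: eq_bigr => s -> /=.
by rewrite /weighted1 /weighted2; ring.
Qed.

(** The process f is h minus its projection p on the cone. It is positive on h
    because E (dot f h) = E (dot f f) + E (dot f p), where the last term is
    nonnegative, and f = 0 would put h in the cone. The two families of dual pairs come
    from - eta at the single date t, which is superhedged by doing nothing, and from
    the portfolio that gives eta away at date t. *)
Lemma separation (h : V) : L2 h -> ~ A h -> exists f : V,
  [/\ L2 f, 0 < E (dot f h),
    forall t, dual_pair P F mu lambda S t (weighted1 f t) (weighted2 f t) &
    forall t, dual_pair P F mu lambda S t (remaining (weighted1 f) t) (remaining (weighted2 f) t)].
Proof.
move=> Hh nAh.
have A0 : A 0.
  apply: superhedgeable_null; first exact: L0_0.
  by move=> t; apply: aeW => w; rewrite oppr0; exact: solvency0.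
have H0 : L2 0.
  by apply: (@L2_bounded _ 0); [exact: L0_0|move=> t w; rewrite /= normr0].
have [p [[Ap Hp] fC fp]] := @cone_projection R V L2 (A `&` L2)
  (fun v => E (dot v v)) (fun u v => E (dot u v)) h Hh (@subIsetr _ _ _)
  (conj A0 H0) L2_lin
  (fun u v c c0 Au Av => conj (superhedgeable_lin mu01 lambda01 S_gt0 c0 Au.1 Av.1)
                              (L2_lin c Au.2 Av.2))
  (fun v _ => Rintegral_ge0 P (fun w _ => dot_ge0 v w)) E_dot_expand
  (fun u_ e Au hu fast => L2_complete Hh Au hu fast).
pose f : V := h - p.
have Hf : L2 f by rewrite /f -scaleN1r; exact: L2_lin.
have hE : h = f + 1 *: p by rewrite scale1r subrK.
exists f; split => //.
- have dotE w : dot f h w = dot f f w + dot f p w.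
    rewrite [in LHS]hE /dot -big_split; apply: eq_bigr => t _.
    by rewrite /= /GRing.scale /=; ring.
  under eq_Rintegral do rewrite dotE.
  rewrite RintegralD //; [|exact: Hf.2|exact: L1_dot].
  apply: ltr_wpDr => //; rewrite ltNge; apply/negP => Ef.
  apply: nAh; have f0 : {ae P, forall w, dot f f w = 0}.
    by apply: E_ge0_eq0 => //; [exact: Hf.2|apply: aeW => w; exact: dot_ge0].
  apply: (superhedgeable_ae_cvg filtF A_closed (u_ := fun=> p)) => [//||t]; first exact: Hh.1.
  apply: filterS f0 => w f0; suff -> : h t w = p t w by split; exact: cvg_cst.
  have /psumr_eq0P f0t : forall s : 'I_T.+1, true -> 0 <=
      rho s w * ((f s w).1 * (f s w).1 + (f s w).2 * (f s w).2).
    by move=> s _; apply: mulr_ge0; [exact: ltW|rewrite addr_ge0 // -expr2 sqr_ge0].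
  have := f0t f0 t isT => /eqP; rewrite mulf_eq0 gt_eqF //= -!expr2.
  rewrite paddr_eq0 ?sqr_ge0 // !sqrf_eq0 => /andP[/eqP f1 /eqP f2].
  by apply/eqP; rewrite -subr_eq0; apply/eqP/pair_equal_spec.
- move=> t eta M meta bM Keta.
  pose v : V := fun s w => if s == t then - eta w else 0.
  have Hv : L2 v by apply: (L2_test meta bM) => // s /eqP->.
  have Av : A v.
    apply: superhedgeable_null; first by case: Hv.
    move=> s; rewrite /v; case: (eqVneq s t) => [->|_].
      by apply: filterS Keta => w; rewrite opprK.
    by apply: aeW => w; rewrite oppr0; exact: solvency0.
  have GE w : (eta w).1 * weighted1 f t w + (eta w).2 * weighted2 f t w = - 1 * dot f v w.
    by rewrite (dot_test f _ (erefl v)) !big_pred1_eq mulN1r opprK.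
  under eq_Rintegral do rewrite GE.
  have := fC v (conj Av Hv); rewrite RintegralZl //; last exact: L1_dot.
  by rewrite -/f; lra.
- move=> t eta M meta bM Keta.
  pose xi : V := fun s w => if s == t then - eta w else 0.
  pose v : V := fun s w => if (t <= s)%N then - eta w else 0.
  have Hxi : L2 xi by apply: (L2_test meta bM) => // s /eqP->.
  have Hv : L2 v by apply: (L2_test (J := fun s => (t <= s)%N) meta bM).
  have vE : v = wealth 0 xi.
    apply/funext => s; apply/funext => w; rewrite /v /wealth add0r -big_mkcondr.
    case: ifPn => ts.
      by rewrite (big_pred1 t) // => r /=; case: (eqVneq r t) => [->|]; rewrite ?ts ?andbF.
    by rewrite big_pred0 // => r /=; case: (eqVneq r t) => [->|]; rewrite ?(negbTE ts) ?andbF.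
  have Av : A v.
    rewrite vE; apply: superhedgeable_wealth; last by rewrite -vE; case: Hv.
    split; first by case: Hxi.
    move=> s; rewrite /xi; case: (eqVneq s t) => [->|_].
      by apply: filterS Keta => w; rewrite opprK.
    by apply: aeW => w; rewrite oppr0; exact: solvency0.
  have GE w : (eta w).1 * remaining (weighted1 f) t w + (eta w).2 * remaining (weighted2 f) t w =
      - 1 * dot f v w.
    by rewrite (dot_test f _ (erefl v)) mulN1r opprK.
  under eq_Rintegral do rewrite GE.
  have := fC v (conj Av Hv); rewrite RintegralZl //; last exact: L1_dot.
  by rewrite -/f; lra.
Qed.

End WeightedL2.
End Separation.

(** * The duality *)

Lemma ereal_between (R : realType) (x y : \bar R) : (x < y)%E ->
  exists r : R, (x < r%:E < y)%E.
Proof.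
case: x y => [x| |] [y| |] //= xy.
- exists ((x + y) / 2); rewrite !lte_fin; move: xy; rewrite lte_fin => xy.
  by apply/andP; split; lra.
- by exists (x + 1); rewrite lte_fin ltry ltrDl ltr01.
- by exists (y - 1); rewrite lte_fin ltNyr gtrBl ltr01.
- by exists 0; rewrite ltNyr ltry.
Qed.

Section Main.
Context {d : measure_display} {Omega : measurableType d} {R : realType}.
Variables (P : probability Omega R) (T : nat) (F : 'I_T.+1 -> set (set Omega)).
Hypothesis filtF : filtration P F.
Variables (mu lambda : R) (S : process T Omega R).
Hypotheses (mu01 : 0 < mu < 1) (lambda01 : 0 < lambda < 1).
Hypothesis S_gt0 : forall t, {ae P, forall w, 0 < S t w}.
Hypothesis S_adapted : L0 F S.
Local Notation K := (solvency mu lambda S).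
Local Notation L1 := (integrable_rv P).
Local Notation E f := (\int[P]_w f w).
Local Notation Fmeas t X := (measurable_fun setT (X : g_sigma_algebraType (F t) -> _)).
Local Notation V := ('I_T.+1 -> Omega -> R * R).
Local Notation A := (superhedgeable P F K 0).

Lemma F_setT t : F t setT.
Proof. exact: (measurable_Gset (F_sigma filtF t) measurableT). Qed.

(** The events of F_0 have probability 0 or 1. *)
Lemma is_condE_F0 (X : Omega -> R) : L1 X ->
  is_condE P (F ord0) (EFin \o X) (cst (E X)%:E).
Proof.
move=> IX; split; [|exact: measurable_cst|].
  by left; exact: integral_funepos_lt_pinfty IX.
have mX := measurable_int _ IX.
move=> B FB; have mB := F_measurable filtF FB.
case: filtF => _ _ _ /(_ _ FB) [PB|PB].
  by rewrite !null_set_integral //; exact: measurable_funTS.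
have PC : P (~` B) = 0%E by rewrite probability_setC // PB subee.
have intB g : P.-integrable setT g -> (\int[P]_(w in B) g w = \int[P]_w g w)%E.
  move=> Ig; rewrite [RHS](negligible_integral (N := ~` B)) //.
  - by rewrite setTD setCK.
  - exact: measurableC.
rewrite !intB //; last exact: finite_measure_integrable_cst.
rewrite integral_cst // -[X in (_ * X)%E]/(P setT) probability_setT mule1 fineK //.
exact: integrable_fin_num IX.
Qed.

Lemma is_condE_F0_unique (X : Omega -> R) (c : \bar R) : L1 X ->
  is_condE P (F ord0) (EFin \o X) (cst c) -> c = (E X)%:E.
Proof.
move=> IX [_ _ /(_ _ (F_setT ord0))].
rewrite integral_cst // -[X in (_ * X)%E]/(P setT) probability_setT mule1 => ->.
by rewrite fineK //; exact: integrable_fin_num IX.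
Qed.

Hypothesis A_closed : closed_in_measure P F A.

Lemma is_condexp_self t (X : Omega -> R) : Fmeas t X -> L1 X -> is_condexp P (F t) X X.
Proof. by []. Qed.

(** The weight exp(-|h|^2) is adapted, positive and at most 1, and it makes
    rho |h|^2 bounded. *)
Lemma strong_duality (theta : V) (x1 : R) : L0 F theta -> ~ Gamma P F K theta (x1, 0) ->
  exists cq c, [/\ Q P F mu lambda S cq,
    is_Eq0 P F cq.2 (fun t w => (theta t w).1 + cq.1 t w * (theta t w).2 * S t w) c%:E &
    x1 < c].
Proof.
move=> mtheta nGamma.
pose h : V := fun t w => theta t w - (x1, 0).
have mh : L0 F h.
  apply/L0_pair => t; have /L0_pair/(_ t)[m1 m2] := mtheta.
  by split; apply: measurable_funB.
have nAh : ~ A h by move=> /(superhedgeable_shift mtheta).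
pose y t w := (h t w).1 ^+ 2 + (h t w).2 ^+ 2.
have y0 t w : 0 <= y t w by rewrite addr_ge0 ?sqr_ge0.
pose rho : process T Omega R := fun t w => expR (- y t w).
have rho0 t w : 0 < rho t w by exact: expR_gt0.
have rho1 t w : rho t w <= 1 by rewrite -expR0 ler_expR oppr_le0.
have mrho : L0 F rho.
  move=> t; have /L0_pair/(_ t)[m1 m2] := mh.
  apply: measurableT_comp => //; apply: measurableT_comp => //.
  by apply: measurable_funD; exact: measurable_funX.
have Hh : L2 P F rho h.
  split => //; apply: (@L1_le _ _ _ _ _ (fun=> \sum_(t < T.+1) 1)).
  - exact: (dot_measurable filtF mrho mh mh).
  - exact: L1_cst.
  apply: aeW => w; rewrite ger0_norm ?(dot_ge0 rho0) //; apply: ler_sum => t _.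
  rewrite -!expr2 -/(y t w) /rho expRN mulrC ler_pdivrMr ?expR_gt0 // mul1r.
  by apply: le_trans (expR_ge1Dx _); rewrite lerDr.
have [f [Hf Efh dual dual_rem]] :=
  separation filtF mu01 lambda01 S_gt0 A_closed rho0 rho1 mrho Hh nAh.
set a := weighted1 rho f in dual dual_rem; set b := weighted2 rho f in dual dual_rem.
have mf t : Fmeas t (fun w => (f t w).1) /\ Fmeas t (fun w => (f t w).2).
  by have /L0_pair := proj1 Hf.
have ma : L0 F a by move=> t; have [m1 _] := mf t; apply: measurable_funM => //; exact: mrho.
have mb : L0 F b by move=> t; have [_ m2] := mf t; apply: measurable_funM => //; exact: mrho.
have Iab (t : 'I_T.+1) (g : Omega -> R) : Fmeas t g ->
    (forall w, g w ^+ 2 <= (f t w).1 ^+ 2 + (f t w).2 ^+ 2) -> L1 (fun w => rho t w * g w).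
  move=> mg gf; have mg' := Fmeas_measurable filtF mg.
  have [Ig _] := L2_component filtF rho0 mrho Hf mg' gf.
  apply: (@L1_le _ _ _ _ _ (fun w => 1 + rho t w * g w ^+ 2)).
  - by apply: measurable_funM => //; exact: (Fmeas_measurable filtF (mrho t)).
  - by apply: L1D => //; exact: L1_cst.
  apply: aeW => w; rewrite normrM gtr0_norm //; have r0 := rho0 t w; have r1 := rho1 t w.
  have := sqr_ge0 (`|g w| - 1); rewrite -[g w ^+ 2]real_normK ?num_real //.
  by have := normr_ge0 (g w); nra.
have Ia t : L1 (a t) by apply: Iab; [exact: (mf t).1|move=> w; rewrite lerDl sqr_ge0].
have Ib t : L1 (b t) by apply: Iab; [exact: (mf t).2|move=> w; rewrite lerDr sqr_ge0].
(* The prices at date t are F_t-measurable, so they are their own conditional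
   expectations. *)
have bounds t := dual_pair_bounds filtF mu01 lambda01 S_gt0 S_adapted (Ia t) (Ib t)
  (is_condexp_self (ma t) (Ia t)) (is_condexp_self (mb t) (Ib t)) (dual t).
pose s w := \sum_(t < T.+1) a t w.
have Is : L1 s by exact: L1_sum.
have [mu0 mu1] := andP mu01; have [la0 _] := andP lambda01.
have a0 t : {ae P, forall w, 0 <= a t w}.
  apply: filterS2 (S_gt0 t) (bounds t) => w S0 [p1 p2].
  have : 0 <= S t w * (mu + lambda) * a t w by lra.
  by rewrite pmulr_rge0 // mulr_gt0 // addr_gt0.
have dotE (v : V) w : dot rho f v w = \sum_(t < T.+1) (a t w * (v t w).1 + b t w * (v t w).2).
  by apply: eq_bigr => t _; rewrite /a /b /weighted1 /weighted2; ring.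
pose Z := E s.
(* If all the first prices vanished, so would the second ones, against
   0 < E (dot rho f h). *)
have Z0 : 0 < Z.
  rewrite ltNge; apply/negP => /(E_ge0_eq0 Is) s0.
  have {}s0 : {ae P, forall w, s w = 0}.
    by apply: s0; apply: filterS (ae_all a0) => w aw; apply: sumr_ge0.
  have : E (dot rho f h) = 0.
    rewrite -(_ : E (fun=> 0) = 0); last by rewrite Rintegral_cst // mul0r.
    apply: eq_E_ae => //; first exact: (dot_measurable filtF mrho Hf.1 mh).
    apply: filterS3 s0 (ae_all a0) (ae_all bounds) => w sw aw bw; rewrite dotE.
    have /psumr_eq0P as0 : forall t : 'I_T.+1, true -> 0 <= a t w by move=> t _.
    apply: big1 => t _; have at0 := as0 sw t isT; have := bw t; rewrite at0.
    move=> [b1 b2]; have -> : b t w = 0 by lra.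
    by rewrite !mul0r addr0.
  by move=> Efh0; move: Efh; rewrite Efh0 ltxx.
pose q : process T Omega R := fun t w => Z^-1 * a t w.
pose p : process T Omega R := fun t w => Z^-1 * b t w.
have remE (u : process T Omega R) t w :
    remaining (fun t w => Z^-1 * u t w) t w = Z^-1 * remaining u t w.
  by rewrite /remaining mulr_sumr.
have [||t|t|t||t|chi Qchi chiE] := @Q_of_prices _ _ _ P T F filtF mu lambda S mu01 lambda01
  S_gt0 S_adapted q p.
- by move=> t; apply: measurable_funM => //; exact: ma.
- by move=> t; apply: measurable_funM => //; exact: mb.
- exact: L1Z.
- exact: L1Z.
- apply: filterS (bounds t) => w [p1 p2]; have Zi : 0 < Z^-1 by rewrite invr_gt0.
  have := ler_wpM2l (ltW Zi) p1; have := ler_wpM2l (ltW Zi) p2.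
  by rewrite /q /p; split; lra.
- under eq_Rintegral do rewrite -mulr_sumr.
  by rewrite RintegralZl // mulVf // gt_eqF.
- move=> eta M meta bM Keta.
  have /(Fmeas_measurable filtF)/measurable_fun_pairP[m1 m2] := meta.
  have e1 w := proj1 (bM w); have e2 w := proj2 (bM w).
  have Ieta : L1 (fun w => (eta w).1 * remaining a t w + (eta w).2 * remaining b t w).
    by apply: L1D; apply: L1M => //; exact: L1_remaining.
  rewrite (_ : (fun w => _) = fun w => Z^-1 *
      ((eta w).1 * remaining a t w + (eta w).2 * remaining b t w)); last first.
    by apply/funext => w; rewrite /q /p !remE; ring.
  rewrite RintegralZl // mulr_ge0 ?invr_ge0 ?(ltW Z0) //.
  exact: dual_rem meta bM Keta.
pose X w := \sum_(t < T.+1) q t w * ((theta t w).1 + chi t w * (theta t w).2 * S t w).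
(* The value of theta is x1 plus the value of h. *)
pose X' w := Z^-1 * (dot rho f h w + x1 * s w).
have IX' : L1 X' by apply/L1Z/L1D; [exact: (L1_dot filtF rho0 mrho Hf Hh)|exact: L1Z].
have XX' : {ae P, forall w, X w = X' w}.
  apply: filterS (ae_all chiE) => w chiw; rewrite /X /X' dotE mulr_sumr -big_split mulr_sumr.
  apply: eq_bigr => t _; have := chiw t; rewrite /p /q /h /= => chi_t.
  transitivity (Z^-1 * a t w * (theta t w).1 +
    (Z^-1 * a t w * (chi t w * S t w)) * (theta t w).2); first by ring.
  by rewrite chi_t; ring.
have mX : measurable_fun setT X.
  have m t (Y : Omega -> R) : Fmeas t Y -> measurable_fun setT Y.
    by move=> mY; exact: (Fmeas_measurable filtF mY).
  have [[mchi _ _] _ _ _ _] := Qchi.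
  apply: measurable_sum => t; have /L0_pair/(_ t)[m1 m2] := mtheta.
  apply: measurable_funM; first exact: L1_measurable (L1Z _ (Ia t)).
  apply: measurable_funD; first exact: m m1.
  apply: measurable_funM; last exact: m (@S_adapted t).
  by apply: measurable_funM; [exact: m (mchi t)|exact: m m2].
have IX : L1 X.
  by apply: (L1_le mX (L1_norm IX')); apply: filterS XX' => w ->.
exists (chi, q), (E X); split => //.
  exact: is_condE_F0.
rewrite (eq_E_ae mX (L1_measurable IX') XX') RintegralZl //; last first.
  by apply: L1D; [exact: (L1_dot filtF rho0 mrho Hf Hh)|exact: L1Z].
rewrite RintegralD ?RintegralZl //; [|exact: (L1_dot filtF rho0 mrho Hf Hh)|exact: L1Z].
by rewrite mulrDr mulrCA mulVf ?gt_eqF // mulr1 ltrDr mulr_gt0 // invr_gt0.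
Qed.

End Main.

Theorem mainTheorem3 (R : realType) (d : measure_display)
    (Omega : measurableType d) (P : probability Omega R)
    (T : nat) (F : 'I_T.+1 -> set (set Omega))
    (mu lambda : R) (S : process T Omega R) :
  (1 <= T)%N ->
  measure_is_complete P ->
  filtration P F ->
  0 < mu < 1 -> 0 < lambda < 1 ->
  L0 F S -> (forall t, {ae P, forall w, 0 < S t w}) ->
  let K := solvency mu lambda S in
  closed_in_measure P F (superhedgeable P F K 0) ->
  terminal_portfolios P F K 0 `&` L0plus_terminal P = zero_terminal P ->
  forall theta : process T Omega (R * R),
    L0 F theta ->
    (exists c : R, forall t,
       {ae P, forall w, c <= (theta t w).1 /\ c <= (theta t w).2}) ->
    ereal_inf [set x1%:E | x1 in [set x1 : R | Gamma P F K theta (x1, 0)]] =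
    ereal_sup [set c : \bar R | exists2 cq, Q P F mu lambda S cq &
      is_Eq0 P F cq.2
        (fun t w => (theta t w).1 + cq.1 t w * (theta t w).2 * S t w) c].
Proof.
move=> _ _ filtF mu01 lambda01 mS S_gt0 K A_closed _ theta mtheta [c theta_ge].
apply/eqP; rewrite eq_le; apply/andP; split; last first.
  apply: ge_ereal_sup => e [[chi q] Qchi /= is_e].
  apply: le_ereal_inf_tmp => _ [x1 x1G <-].
  have [qp Eq1] := Q_consistent filtF mu01 lambda01 S_gt0 mS Qchi (erefl _).
  have [IX EX] := weak_duality filtF mu01 lambda01 S_gt0 qp Eq1 mtheta theta_ge x1G (erefl _).
  set X := (fun w => _) in IX EX.
  have Xe : is_condE P (F ord0) (EFin \o X) (cst e).
    move: is_e; rewrite /is_Eq0 /is_Eq; congr (is_condE _ _ _ _).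
    apply/funext => w; congr _%:E; apply: eq_bigr => t _; ring.
  by rewrite (is_condE_F0_unique filtF IX Xe) lee_fin.
(* A real number strictly inside a gap could not superhedge, and strong
   duality would push the supremum above it. *)
rewrite leNgt; apply/negP => gap.
have [x1 /andP[sup_x1 x1_inf]] := ereal_between gap.
have nG : ~ Gamma P F K theta (x1, 0).
  move=> G; move: x1_inf; rewrite ltNge => /negP; apply.
  by apply: ereal_inf_lbound; exists x1.
have [cq [v [Qcq is_v x1v]]] := strong_duality filtF mu01 lambda01 S_gt0 mS A_closed mtheta nG.
move: sup_x1; rewrite ltNge => /negP; apply.
apply: (@le_trans _ _ v%:E); first by rewrite lee_fin ltW.
by apply: ereal_sup_ubound; exists cq.
Qed.
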